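(* Let $(\mathcal D,\mathcal C,E_0)$ satisfy Hypothesis H (defined in the context). Let $\Omega\subset\mathbb R^N$ be an open set satisfying the boundary condition $\Omega\setminus\overline{\mathcal C}=E_0\setminus\overline{\mathcal C}$. If there exists a constant $C>0$ such that for every open set $\tilde\omega\subset\Omega$ satisfying $\tilde\omega\setminus\overline{\mathcal C}=E_0\setminus\overline{\mathcal C}$, $$|\Omega\setminus\tilde\omega|\le C\,P(\tilde\omega,\Omega)^{\frac{N}{N-1}},$$ then $\Omega$ is a domain of isoperimetry.
   Context: Notation. $N\ge 2$ is the ambient dimension, $B(x,r)$ is the open ball, $|E|$ is Lebesgue measure, $\mathcal H^{N-1}$ is Hausdorff measure, $\partial E$ is the topological boundary. $E^{(t)}$ is the set of points where $E$ has Lebesgue density $t$; the essential boundary is $\partial^*E=\mathbb R^N\setminus(E^{(0)}\cup E^{(1)})$. $P(E,U)\in[0,+\infty]$ is the De Giorgi perimeter of $E$ in $U$. The identity $\partial^*E_0=\partial E_0$ below is understood inside $\mathcal D$. Domain of isoperimetry. An open set $\Omega\subset\mathbb R^N$ such that for some $C>0$, every open $\omega\subset\Omega$ satisfies $\min(|\omega|,|\Omega\setminus\omega|)\le C\,\mathcal H^{N-1}(\partial\omega\cap\Omega)^{N/(N-1)}$. Ahlfors regularity. A relatively closed subset $S$ of an open set $U$ is Ahlfors regular in $U$ if there are $C_1,C_2>0$ with $C_1r^{N-1}\le\mathcal H^{N-1}(S\cap B(x,r))\le C_2r^{N-1}$ for all $x\in S$ and $r>0$ with $B(x,r)\subset U$.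 ''$\partial E$ is Ahlfors regular in $\mathcal D$'' refers to $\partial E\cap\mathcal D$. Hypothesis H for $(\mathcal D,\mathcal C,E_0)$: $\mathcal D\subset\mathbb R^N$ is an open bounded domain; $\mathcal C\subset\mathcal D$ is open, convex, nonempty; $E_0\subset\mathcal D$ is a Borel set of finite perimeter in $\mathcal D$ with $\partial^*E_0=\partial E_0$; and, with $\Sigma:=\partial E_0\cap(\mathcal D\setminus\overline{\mathcal C})$: (i) there are $C_1,C_2>0$ such that $C_1r^{N-1}\le\mathcal H^{N-1}(\Sigma\cap B(x,r))\le C_2r^{N-1}$ for all $x\in\Sigma$, $r>0$ with $B(x,r)\subset\mathcal D$; (ii) (Condition B') $E_0$ is open, $\partial E_0$ is Ahlfors regular in $\mathcal D$, and there is $C>1$ such that for all $x\in\partial E_0\setminus\overline{\mathcal C}$ and $r>0$ with $B(x,r)\subset\mathcal D$ there are balls $B_1\subset(B(x,r)\cap E_0)\setminus\overline{\mathcal C}$ and $B_2\subset(B(x,r)\setminus\overline{E_0})\setminus\overline{\mathcal C}$ of radii at least $C^{-1}r$; (iii) $E_0\setminus\overline{\mathcal C}$ and $(\mathcal D\setminus\overline{E_0})\setminus\overline{\mathcal C}$ are domains of isoperimetry. *)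

(* Defs.v *)
From HB Require Import structures.
From mathcomp Require Import all_boot all_order all_algebra.
From mathcomp Require Import all_classical all_reals all_analysis.

Set Implicit Arguments.
Unset Strict Implicit.
Unset Printing Implicit Defensive.
Import Order.TTheory GRing.Theory Num.Theory.
Import numFieldNormedType.Exports.
Local Open Scope classical_set_scope.
Local Open Scope ring_scope.

(* The library norm on 'rV[R]_n is the sup norm: it gives the usual topology and
   the usual bounded sets, but lengths and balls below have to be Euclidean. *)
Definition enorm (R : realType) (n : nat) (x : 'rV[R]_n) : R :=
  Num.sqrt (\sum_(i < n) x 0 i ^+ 2).

Definition eball (R : realType) (n : nat) (x : 'rV[R]_n) (r : R) :
    set 'rV[R]_n :=
  [set y | enorm (y - x) < r].

Definition tboundary (T : topologicalType) (A : set T) : set T :=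
  closure A `\` interior A.

(* Lebesgue measure on R^n: the outer measure generated by countable covers by
   closed boxes, restricted to its Caratheodory-measurable sets. [None] is the
   empty box; it is needed only to have the empty set null when n = 0. *)
Section lebesgue.
Context (R : realType) (n : nat).
Local Open Scope ereal_scope.

Definition box (c : option ('rV[R]_n * 'rV[R]_n)) : set 'rV[R]_n :=
  if c is Some ab then [set x | forall i, (ab.1 0 i <= x 0 i <= ab.2 0 i)%R]
  else set0.

Definition box_volume (c : option ('rV[R]_n * 'rV[R]_n)) : R :=
  if c is Some ab then \prod_(i < n) Num.max 0%R (ab.2 0 i - ab.1 0 i)%R else 0%R.

Definition leb (A : set 'rV[R]_n) : \bar R :=
  ereal_inf [set \sum_(k <oo) (box_volume (c k))%:E
            | c in [set c | A `<=` \bigcup_k box (c k)]].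

Lemma box_volume_ge0 c : (0 <= box_volume c)%R.
Proof.
case: c => [[a b]|//] /=; apply: prodr_ge0 => i _.
by rewrite le_max lexx.
Qed.

Lemma leb_ge0 A : 0 <= leb A.
Proof.
apply: le_ereal_inf_tmp => x [c _ <-{x}].
by apply: nneseries_ge0 => k _ _; rewrite lee_fin box_volume_ge0.
Qed.

Lemma leb_le : {homo leb : A B / A `<=` B >-> A <= B}.
Proof.
move=> A B AB; apply/ereal_inf_le_tmp => x [c Bc <-{x}].
by exists c => //; exact: subset_trans AB Bc.
Qed.

Lemma leb_set0 : leb set0 = 0.
Proof.
apply/eqP; rewrite eq_le leb_ge0 andbT; apply: ereal_inf_lbound.
by exists (fun=> None) => //=; rewrite eseries0.
Qed.

Lemma leb_sigma_subadditive : sigma_subadditive leb.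
Proof.
move=> A; have [[i ioo]|] := pselect (exists i, leb (A i) = +oo).
  rewrite (eseries_pinfty _ _ ioo) ?leey// => k _.
  by rewrite -ltNye (lt_le_trans _ (leb_ge0 _)).
rewrite -forallNE => Aoo.
suff add2e (e : {posnum R}) :
    leb (\bigcup_k A k) <= \sum_(i <oo) leb (A i) + e%:num%:E.
  by apply/lee_addgt0Pr => _/posnumP[].
rewrite (le_trans _ (epsilon_trick _ _ _))//; last first.
  by move=> k; exact: leb_ge0.
pose P k (c : nat -> option ('rV[R]_n * 'rV[R]_n)) :=
  A k `<=` \bigcup_j box (c j) /\
  \sum_(j <oo) (box_volume (c j))%:E <= leb (A k) + (e%:num / (2 ^ k.+1)%:R)%:E.
have [G PG] : {G & forall k, P k (G k)}.
  apply: (@choice _ _ P) => k; rewrite /P.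
  have en1 : (0 < e%:num / (2 ^ k.+1)%:R)%R by [].
  have fk : leb (A k) \is a fin_num.
    by rewrite ge0_fin_numE ?leb_ge0// ltey; apply/eqP; exact: Aoo.
  have [x [c Ac <-] xS] := lb_ereal_inf_adherent en1 fk.
  by exists c; split => //; exact/ltW.
pose vol := (fun c => (box_volume c)%:E).
have vol_ge0 x : 0 <= (vol \o uncurry G) x by rewrite lee_fin box_volume_ge0.
apply: (@le_trans _ _ (\esum_(i in setT) (vol \o uncurry G) i)).
  apply: ereal_inf_lbound => /=.
  have /card_esym/ppcard_eqP[f] := card_nat2.
  exists (uncurry G \o f).
    move=> t [i _] /(PG i).1[j _ Gijt]; exists (f^-1%FUN (i, j)) => //=.
    by rewrite invK ?inE.
  rewrite -(esum_pred_image (vol \o uncurry G) _ xpredT) ?[fun=> _]set_true//.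
  by rewrite image_eq.
rewrite (_ : esum _ _ = \sum_(i <oo) \sum_(j <oo) vol (G i j)); last first.
  pose J : nat -> set (nat * nat) := fun i => [set (i, j) | j in setT].
  rewrite (_ : setT = \bigcup_k J k); last first.
    by rewrite predeqE => -[a b]; split => // _; exists a => //; exists b.
  rewrite esum_bigcupT /=; last 2 first.
    - apply/trivIsetP => i j _ _ ij.
      rewrite predeqE => -[k m] /=; split => //= -[] [_] _ [<-{k} _].
      by move=> [m' _] [] /esym/eqP; rewrite (negbTE ij).
    - by move=> k; exact: vol_ge0.
  rewrite -(image_id [set: nat]) -fun_true esum_pred_image//; last first.
    by move=> k _; apply: esum_ge0 => ? _; exact: vol_ge0.
  apply: eq_eseriesr => /= j _.
  rewrite -(esum_pred_image (vol \o uncurry G) (pair j) predT)//=; last 2 first.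
    by move=> k _; exact: (vol_ge0 (j, k)).
    by move=> ? ? _ _; exact: (@can_inj _ _ _ snd).
  by congr esum; rewrite predeqE => -[a b]; split; move=> [i _ <-]; exists i.
apply: lee_nneseries => [k _ _|k _].
  by apply: nneseries_ge0 => m _ _; exact: (vol_ge0 (k, m)).
exact: (PG k).2.
Qed.

HB.instance Definition _ := isOuterMeasure.Build R 'rV[R]_n leb
  leb_set0 leb_ge0 leb_le leb_sigma_subadditive.

End lebesgue.

Section hausdorff.
Context (R : realType) (n : nat).
Implicit Types A : set 'rV[R]_n.
Local Open Scope ereal_scope.

Definition diam A : \bar R :=
  maxe 0 (ereal_sup [set (enorm (x - y))%:E | x in A & y in A]).

(* The usual normalization: |B^s(0,1)| (diam / 2)^s, so that the s-dimensional
   measure agrees with Lebesgue measure on s-planes. Meant for s > 0 only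
   (for s = 0, empty members of a cover would be counted). *)
Definition hausdorff_weight (s : nat) A : \bar R :=
  leb (@eball R s 0 1) * ((fine (diam A) / 2) ^+ s)%:E.

Definition hausdorff_delta (s : nat) (delta : R) A : \bar R :=
  ereal_inf [set \sum_(k <oo) hausdorff_weight s (F k)
            | F in [set F : nat -> set 'rV[R]_n |
                (forall k, diam (F k) <= delta%:E) /\ A `<=` \bigcup_k F k]].

Definition hausdorff (s : nat) A : \bar R :=
  ereal_sup [set hausdorff_delta s delta A | delta in [set d : R | (0 < d)%R]].

End hausdorff.

Section perimeter.
Context (R : realType) (n : nat).
Implicit Types (E U : set 'rV[R]_n) (phi : 'rV[R]_n -> 'rV[R]_n).

Definition C1c_field U phi : Prop :=
  [/\ forall x, differentiable phi x,
      continuous (fun x => jacobian phi x) &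
      exists K : set 'rV[R]_n,
        [/\ compact K, K `<=` U & forall x, ~ K x -> phi x = 0]].

Definition divergence phi (x : 'rV[R]_n) : R := \tr (jacobian phi x).

Definition perimeter E U : \bar R :=
  ereal_sup [set (\int[(@leb R n : set (caratheodory_type (@leb R n)) -> \bar R)]_(x in E)
                    (divergence phi x)%:E)%E
            | phi in [set phi | C1c_field U phi /\
                                forall x, enorm (phi x) <= 1]].

End perimeter.

Section density.
Context (R : realType) (n : nat).
Implicit Types (E : set 'rV[R]_n).

Definition density_set E (t : R) : set 'rV[R]_n :=
  [set x | (fun r : R => fine (leb (E `&` eball x r)) / fine (leb (eball x r)))
             @ 0^'+ --> t].

Definition ess_boundary E : set 'rV[R]_n :=
  ~` (density_set E 0 `|` density_set E 1).

Definition borel_set E : Prop := <<s [set U : set 'rV[R]_n | open U] >> E.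

End density.

Section geometry.
Context (R : realType) (N : nat).
Implicit Types (D C U S Omega : set 'rV[R]_N).

Definition isoperimetry_domain Omega : Prop :=
  open Omega /\
  exists2 c : R, 0 < c &
    forall omega : set 'rV[R]_N, open omega -> omega `<=` Omega ->
      (mine (leb omega) (leb (Omega `\` omega)) <=
       c%:E * (hausdorff N.-1 (tboundary omega `&` Omega)
                 `^ (N%:R / N.-1%:R)))%E.

Definition ahlfors_bounds U S : Prop :=
  exists c1 c2 : R, [/\ 0 < c1, 0 < c2 &
    forall (x : 'rV[R]_N) (r : R), S x -> 0 < r -> eball x r `<=` U ->
      ((c1 * r ^+ N.-1)%:E <= hausdorff N.-1 (S `&` eball x r) /\
       hausdorff N.-1 (S `&` eball x r) <= (c2 * r ^+ N.-1)%:E)%E].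

Definition ahlfors_regular U S : Prop :=
  (exists2 F : set 'rV[R]_N, closed F & S = F `&` U) /\ ahlfors_bounds U S.

Definition conditionB' D C (E0 : set 'rV[R]_N) : Prop :=
  [/\ open E0, ahlfors_regular D (tboundary E0 `&` D) &
      exists2 c : R, 1 < c &
        forall (x : 'rV[R]_N) (r : R),
          (tboundary E0 `\` closure C) x -> 0 < r -> eball x r `<=` D ->
          (exists (y : 'rV[R]_N) (s : R), c^-1 * r <= s /\
             eball y s `<=` (eball x r `&` E0) `\` closure C) /\
          (exists (y : 'rV[R]_N) (s : R), c^-1 * r <= s /\
             eball y s `<=` (eball x r `\` closure E0) `\` closure C)].

Record hypothesisH D C (E0 : set 'rV[R]_N) : Prop := HypothesisH {
  hypH_D_open : open D ;
  hypH_D_bounded : bounded_set D ;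
  hypH_D_connected : connected D ;
  hypH_C_sub : C `<=` D ;
  hypH_C_open : open C ;
  hypH_C_convex : convex_set (C : set (convex_lmodType 'rV[R]_N)) ;
  hypH_C_nonempty : C !=set0 ;
  hypH_E0_sub : E0 `<=` D ;
  hypH_E0_borel : borel_set E0 ;
  hypH_E0_perimeter : (perimeter E0 D < +oo)%E ;
  hypH_E0_boundary : ess_boundary E0 `&` D = tboundary E0 `&` D ;
  hypH_density : ahlfors_bounds D (tboundary E0 `&` (D `\` closure C)) ;
  hypH_conditionB' : conditionB' D C E0 ;
  hypH_isoperimetry_in : isoperimetry_domain (E0 `\` closure C) ;
  hypH_isoperimetry_out : isoperimetry_domain ((D `\` closure E0) `\` closure C)
}.

End geometry.

(* Main.v *)
(* Put A = E0 \ closure C = Omega \ closure C, and let w be an open subset of Omega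
   with relative boundary of measure y^(N-1). By isoperimetry of A, either w or A \ w
   has volume at most c y^N inside A; replacing w by Omega \ closure w exchanges the two
   cases, so assume that |A \ w| <= c y^N with y small. The hypothesis on Omega only
   controls competitors that contain A, and w `|` A has new boundary on the boundary of C.
   At a point x of this new boundary the complement of the convex set C has positive
   density. If the boundary of w had small density in A around x at all scales, then,
   cutting A \ w by spheres around x, isoperimetry of A would force the volume of A \ w
   in the ball of radius r to be at most b r^N with b small for all r = 2^-k, against
   this density. Hence some ball of radius r(x) contains boundary of w of measure at
   least of order r(x)^(N-1). A Vitali selection among these balls gives a countable
   union U of balls, with the sum of r^(N-1) bounded by y^(N-1), covering the new
   boundary, and the competitor w `|` A `|` (Omega `&` U) has perimeter of order
   y^(N-1). All balls are balls of the sup norm. *)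
Require Import Defs.
From mathcomp Require Import all_boot all_order all_algebra.
From mathcomp Require Import all_classical all_reals all_analysis.
From mathcomp Require Import measurable_realfun ring lra.
Set Implicit Arguments.
Unset Strict Implicit.
Unset Printing Implicit Defensive.
Import Order.TTheory GRing.Theory Num.Theory.
Import numFieldNormedType.Exports.
Local Open Scope classical_set_scope.
Local Open Scope ring_scope.

(** * Countable covers *)

(** The hypothesis on [Omega] speaks of perimeter, the conclusion of the Hausdorff measure of a
    topological boundary. The only bridge needed is that the perimeter of an open set is at most a
    constant times the measure of its boundary; it is obtained by covering the boundary with small
    cubes, whose faces are easy to measure. As no constant has to be sharp, sup norm balls suffice
    although [hausdorff] is Euclidean. [hausdorff] is handled as an outer measure throughout.
    Additivity on Borel sets is replaced by superadditivity on sets at positive distance, which is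
    why the Vitali selection is run with doubled radii. The radii of the added balls are then
    enlarged to values at which the spheres have controlled measure. Smallness of y serves twice: it
    starts the descent of radii at scale 1, and it makes A \ w at most half of A, so that
    isoperimetry bounds the intended piece. For other y the inequality is trivial because Omega is
    bounded. Replacing w by Omega \ closure w overlooks the boundary of w, which is Lebesgue null as
    its (N-1)-measure is finite. *)

Section countable_covers.
Context (R : realType) (T I : Type) (adm : set I) (S : I -> set T)
  (w : I -> \bar R).
Hypothesis w_ge0 : forall i, (0 <= w i)%E.
Local Open Scope ereal_scope.

(** The common form of [hausdorff_delta] (sets of small diameter) and of [cube_cost] (small cubes):
    [adm] restricts the members of a cover, so that subadditivity is proved once for both. *)
Definition cover_cost (A : set T) : \bar R :=
  ereal_inf [set \sum_(k <oo) w (c k)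
            | c in [set c : nat -> I | (forall k, adm (c k)) /\
                                       A `<=` \bigcup_k S (c k)]].

Lemma cover_cost_ge0 A : 0 <= cover_cost A.
Proof.
by apply: le_ereal_inf_tmp => _ [c _ <-]; apply: nneseries_ge0.
Qed.

Lemma le_cover_cost : {homo cover_cost : A B / A `<=` B >-> A <= B}.
Proof.
move=> A B AB; apply/ereal_inf_le_tmp => _ [c [cadm Bc] <-].
by exists c => //; split => //; exact: subset_trans AB Bc.
Qed.

Lemma cover_cost_lt A v : cover_cost A < v ->
  exists c : nat -> I, [/\ forall k, adm (c k), A `<=` \bigcup_k S (c k) &
    \sum_(k <oo) w (c k) < v].
Proof. by move=> /ereal_inf_lt[_ [c [cadm Ac] <-] cv]; exists c. Qed.

Lemma cover_cost_sigma_subadditive : sigma_subadditive cover_cost.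
Proof.
move=> A.
have [sumoo|/eqP sumoo] := eqVneq (\sum_(k <oo) cover_cost (A k)) +oo.
  by rewrite sumoo leey.
apply/lee_addgt0Pr => e e0.
have Afin k : cover_cost (A k) \is a fin_num.
  rewrite ge0_fin_numE ?cover_cost_ge0// ltey; apply/eqP => Akoo.
  by apply: sumoo; apply: (eseries_pinfty _ _ Akoo) => // j _;
    rewrite -ltNye (lt_le_trans _ (cover_cost_ge0 _)).
have pick k : {c : nat -> I | [/\ forall j, adm (c j),
    A k `<=` \bigcup_j S (c j) &
    \sum_(j <oo) w (c j) < cover_cost (A k) + (e / (2 ^ k.+1)%:R)%:E]}.
  apply: cid; apply: cover_cost_lt.
  by rewrite lteDl// lte_fin divr_gt0// ltr0n expn_gt0.
have [f fbij] := card_set_bijP (card_esym card_nat2).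
pose c n := sval (pick (f n).1) (f n).2.
apply: le_trans (epsilon_trick _ _ (ltW e0)); last first.
  by move=> k; exact: cover_cost_ge0.
apply: (@le_trans _ _ (\sum_(k <oo) w (c k))).
  apply: ereal_inf_lbound; exists c => //; split.
    by move=> n; rewrite /c; case: (svalP (pick (f n).1)).
  move=> x [k _]; case: (svalP (pick k)) => _ + _ => /[apply] -[j _ Sj].
  have [n _ fn] : (f @` setT) (k, j) by case: fbij => _ _; apply.
  by exists n => //; rewrite /c fn.
have -> : \sum_(k <oo) w (c k) = \sum_(i <oo) \sum_(j <oo) w (sval (pick i) j).
  rewrite nneseries_esumT// nneseries_esumT; last first.
    by move=> n; apply: nneseries_ge0.
  under [RHS]eq_esum do rewrite nneseries_esumT//.
  rewrite esum_esum//.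
  rewrite (_ : setT `*`` _ = setT); last by apply/seteqP; split.
  by rewrite (reindex_esum setT setT f).
apply: lee_nneseries => [k _ _|k _]; first exact: nneseries_ge0.
by case: (svalP (pick k)) => _ _ /ltW.
Qed.

End countable_covers.

(** * The sup norm and Lebesgue measure *)

Section supnorm.
Context (R : realType) (n : nat).
Implicit Types (x y : 'rV[R]_n) (r : R).

Lemma row_norm_leP x r : 0 <= r ->
  `|x| <= r <-> forall i, `|x 0 i| <= r.
Proof.
move=> r0; have -> : `|x| = mx_norm x by []; rewrite mx_normrE; split.
  by move=> /bigmax_leP[_ xr] i; exact: (xr (0, i) isT).
by move=> xr; apply/bigmax_leP; split => // -[j i] _ /=; rewrite ord1.
Qed.

Lemma row_norm_ltP x r : 0 < r ->
  `|x| < r <-> forall i, `|x 0 i| < r.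
Proof.
move=> r0; have -> : `|x| = mx_norm x by []; rewrite mx_normrE; split.
  by move=> /bigmax_ltP[_ xr] i; exact: (xr (0, i) isT).
by move=> xr; apply/bigmax_ltP; split => // -[j i] _ /=; rewrite ord1.
Qed.

Lemma coord_le_norm x i : `|x 0 i| <= `|x|.
Proof. by have /row_norm_leP/(_ i) := lexx `|x|; apply. Qed.

Lemma ball_rowE x r : ball x r = [set y | `|x - y| < r].
Proof. by rewrite -ball_normE. Qed.

Lemma norm_le_enorm x : `|x| <= enorm x.
Proof.
apply/row_norm_leP => [|i]; first exact: sqrtr_ge0.
rewrite -sqrtr_sqr ler_wsqrtr// (bigD1 i)//= lerDl.
by apply: sumr_ge0 => j _; exact: sqr_ge0.
Qed.

Lemma enorm_le_norm x : enorm x <= n%:R * `|x|.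
Proof.
rewrite -[leRHS]ger0_norm ?mulr_ge0// -sqrtr_sqr ler_wsqrtr//.
apply: (@le_trans _ _ (n%:R * `|x| ^+ 2)).
  have -> : n%:R * `|x| ^+ 2 = \sum_(i < n) `|x| ^+ 2.
    by rewrite sumr_const card_ord mulr_natl.
  apply: ler_sum => i _.
  by rewrite -[leLHS]real_normK ?num_real// ler_sqr ?nnegrE// coord_le_norm.
rewrite exprMn ler_wpM2r ?sqr_ge0// -natrX ler_nat.
by case: n {x} => // m; rewrite expnS expn1 leq_pmulr.
Qed.

End supnorm.

Section intervals.
Context (R : realType).
Notation mu := (@lebesgue_measure R).

Lemma measurable_interval_sum (p q w : nat -> R) (D : set R) :
  (forall k, 0 <= w k) ->
  measurable_fun D (fun t => \sum_(k <oo) (w k * \1_(`[p k, q k]) t)%:E)%E.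
Proof.
move=> w0; apply: ge0_emeasurable_sum => [k t _ _|k _].
  by rewrite lee_fin mulr_ge0.
by apply/measurable_EFinP/measurable_funM => //; exact: measurable_indic.
Qed.

(** Tonelli for weighted intervals. It serves twice: with the sides of boxes in the lower bound for
    volumes, and with the ranges of the distance to a point in the slicing by spheres. *)
Lemma integral_interval_sum_le (p q w : nat -> R) (D : set R) :
  measurable D -> (forall k, 0 <= w k) ->
  (\int[mu]_(t in D) \sum_(k <oo) (w k * \1_(`[p k, q k]) t)%:E <=
   \sum_(k <oo) (w k * Num.max 0 (q k - p k))%:E)%E.
Proof.
move=> mD w0; rewrite integral_nneseries//; last 2 first.
- move=> k; apply/measurable_EFinP/measurable_funM => //.
- by move=> k t _; rewrite lee_fin mulr_ge0.
apply: lee_nneseries => [k _ _|k _].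
  by apply: integral_ge0 => t _; rewrite lee_fin mulr_ge0.
under eq_integral do rewrite EFinM.
rewrite ge0_integralZl_EFin//; last first.
- by apply/measurable_EFinP; exact: measurable_indic.
rewrite EFinM lee_wpmul2l ?lee_fin// integral_indic//.
apply: (@le_trans _ _ (mu `[p k, q k]%classic)); first exact: measureIl.
rewrite lebesgue_measure_itv/=; case: ifPn => [pq|_].
  by rewrite -EFinB lee_fin le_max lexx orbT.
by rewrite lee_fin le_max lexx.
Qed.

End intervals.

Lemma lebesgue_measure_cc (R : realType) (a b : R) : a <= b ->
  lebesgue_measure `[a, b] = (b - a)%:E.
Proof.
move=> ab; rewrite lebesgue_measure_itv/= lte_fin; case: ifPn => //.
by rewrite -leNgt => ba; rewrite (le_anti (introT andP (conj ab ba))) subrr.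
Qed.

Section box_volume_lower_bound.
Context (R : realType).
Notation mu := (@lebesgue_measure R).

Definition row_tail n (x : 'rV[R]_n.+1) : 'rV[R]_n := \row_j x 0 (lift ord0 j).

Definition row_cons n (t : R) (x : 'rV[R]_n) : 'rV[R]_n.+1 :=
  \row_i (if unlift ord0 i is Some j then x 0 j else t).

Lemma row_consE n (a b x : 'rV[R]_n.+1) : box (Some (a, b)) x <->
  (a 0 ord0 <= x 0 ord0 <= b 0 ord0) /\
  box (Some (row_tail a, row_tail b)) (row_tail x).
Proof.
split=> [abx|[ab0 abx] i]; first by split => // i; rewrite !mxE; exact: abx.
by case: (unliftP ord0 i) => [j|] -> //; have := abx j; rewrite !mxE.
Qed.

Lemma row_cons0 n (t : R) (x : 'rV[R]_n) : row_cons t x 0 ord0 = t.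
Proof. by rewrite mxE unlift_none. Qed.

Lemma row_consK n (t : R) (x : 'rV[R]_n) : row_tail (row_cons t x) = x.
Proof. by apply/rowP => j; rewrite !mxE liftK. Qed.

Definition box_section n (t : R) (c : option ('rV[R]_n.+1 * 'rV[R]_n.+1)) :
    option ('rV[R]_n * 'rV[R]_n) :=
  if c is Some ab then
    if (ab.1 0 ord0 <= t <= ab.2 0 ord0) then Some (row_tail ab.1, row_tail ab.2)
    else None
  else None.

(* Induction on n: the sections of the cover at height t cover the section of the box,
   and the resulting inequality is integrated over t. *)
Lemma box_volume_le_cover n (a b : 'rV[R]_n)
    (c : nat -> option ('rV[R]_n * 'rV[R]_n)) :
  (forall i, a 0 i <= b 0 i) ->
  box (Some (a, b)) `<=` \bigcup_k box (c k) ->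
  ((box_volume (Some (a, b)))%:E <= \sum_(k <oo) (box_volume (c k))%:E)%E.
Proof.
elim: n a b c => [|n IH] a b c ab cover.
  (* In dimension 0 a nonempty box has volume 1, the empty product, and some member of the cover
     must be nonempty. *)
  have [|k _ ck] := cover a; first by case.
  apply: (@le_trans _ _ (box_volume (c k))%:E).
    by move: ck; case: (c k) => // [[u v] _] /=; rewrite !big_ord0.
  rewrite (nneseriesD1 (n := k))//= ?leeDl//.
    by apply: nneseries_ge0 => j _ _; rewrite lee_fin box_volume_ge0.
  by move=> j _; rewrite lee_fin box_volume_ge0.
pose p k := if c k is Some uv then uv.1 0 ord0 else 0.
pose q k := if c k is Some uv then uv.2 0 ord0 else 0.
pose w k := if c k is Some uv then
  box_volume (Some (row_tail uv.1, row_tail uv.2)) else 0.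
have w0 k : 0 <= w k by rewrite /w; case: (c k) => // ?; exact: box_volume_ge0.
pose J := [set` `[a 0 ord0, b 0 ord0]].
have mJ : measurable J by exact: measurable_itv.
pose v := box_volume (Some (row_tail a, row_tail b)).
have volE (u u' : 'rV[R]_n.+1) : box_volume (Some (u, u')) =
    box_volume (Some (row_tail u, row_tail u')) *
    Num.max 0 (u' 0 ord0 - u 0 ord0).
  rewrite /= big_ord_recl mulrC; congr (_ * _).
  by apply: eq_bigr => i _; rewrite !mxE.
have -> : (\sum_(k <oo) (box_volume (c k))%:E =
    \sum_(k <oo) (w k * Num.max 0 (q k - p k))%:E)%E.
  apply: eq_eseriesr => k _; rewrite /w /q /p.
  by case: (c k) => [[u u']|]; rewrite ?volE//= mul0r.
apply: le_trans (integral_interval_sum_le p q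
  (D := J) (measurable_itv _) w0).
apply: (@le_trans _ _ (\int[mu]_(t in J) cst v%:E t)%E).
  rewrite integral_cst; last exact: measurable_itv.
  rewrite [X in (_ * X)%E](_ : _ = (b 0 ord0 - a 0 ord0)%:E); last first.
    by rewrite -lebesgue_measure_cc.
  by rewrite volE EFinM max_r ?subr_ge0.
apply: ge0_le_integral => //.
- by move=> t _; rewrite lee_fin box_volume_ge0.
- exact: measurable_interval_sum.
move=> t; rewrite /J/= in_itv/= => abt.
apply: le_trans (IH _ _ (box_section t \o c) _ _) _.
- by move=> i; rewrite !mxE.
- move=> x abx.
  have [|k _ ck] := cover (row_cons t x).
    by apply/row_consE; rewrite row_cons0 row_consK.
  exists k => //=; move: ck; case: (c k) => // [[u u']].
  by move=> /row_consE; rewrite row_cons0 row_consK /= => -[-> ].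
apply: lee_nneseries => [k _ _|k _]; first by rewrite lee_fin box_volume_ge0.
rewrite lee_fin /w /p /q /=; case: (c k) => [[u u']|] /=; last by rewrite mul0r.
by rewrite indicE mem_setE in_itv/=; case: ifPn => _; rewrite ?mulr1 ?mulr0.
Qed.

End box_volume_lower_bound.

Section leb_boxes.
Context (R : realType) (n : nat).
Implicit Types (x : 'rV[R]_n) (r : R).

Lemma leb_box_le (a b : 'rV[R]_n) :
  (leb (box (Some (a, b))) <= (box_volume (Some (a, b)))%:E)%E.
Proof.
apply: ereal_inf_lbound; exists (fun k => if k == 0%N then Some (a, b) else None).
  by move=> x abx; exists 0%N.
rewrite (nneseriesD1 (n := 0%N))//=; last first.
  by move=> k _; rewrite lee_fin box_volume_ge0.
by rewrite eseries0 ?adde0// => k _ /negbTE /= ->.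
Qed.

Lemma leb_box_ge (a b : 'rV[R]_n) : (forall i, a 0 i <= b 0 i) ->
  ((box_volume (Some (a, b)))%:E <= leb (box (Some (a, b))))%E.
Proof.
by move=> ab; apply: le_ereal_inf_tmp => _ [c abc <-]; exact: box_volume_le_cover.
Qed.

Definition cube x r : set 'rV[R]_n :=
  box (Some (x - const_mx r, x + const_mx r)).

Lemma cubeE x r : 0 <= r -> cube x r = [set y | `|x - y| <= r].
Proof.
move=> r0; apply/seteqP; split => y /=.
  move=> xy; apply/row_norm_leP => // i; have := xy i; rewrite !mxE ler_norml.
  by lra.
move=> /(row_norm_leP _ r0) xy i; have := xy i; rewrite !mxE ler_norml.
by lra.
Qed.

Lemma cube_volume x r : 0 <= r ->
  box_volume (Some (x - const_mx r, x + const_mx r)) = (2 * r) ^+ n.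
Proof.
move=> r0 /=; under eq_bigr => i _.
  rewrite !mxE (_ : _ - _ = 2 * r); last by ring.
  rewrite max_r ?mulr_ge0//; over.
by rewrite prodr_const card_ord.
Qed.

Lemma leb_ball_le x r : 0 <= r -> (leb (ball x r) <= ((2 * r) ^+ n)%:E)%E.
Proof.
move=> r0; rewrite -(cube_volume x r0); apply: le_trans (leb_box_le _ _); apply: leb_le.
by rewrite -/(cube x r) cubeE// ball_rowE => y /= /ltW.
Qed.


Lemma leb_ball_ge x r : 0 < r -> ((r ^+ n)%:E <= leb (ball x r))%E.
Proof.
move=> r0; have r20 : 0 <= r / 2 by rewrite divr_ge0// ltW.
rewrite (_ : r = 2 * (r / 2)); last by field.
rewrite -(cube_volume x r20).
apply: le_trans (leb_box_ge _) _ => [i|]; first by rewrite !mxE; lra.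
apply: leb_le; rewrite -/(cube _ _) cubeE// ball_rowE => y /= /le_lt_trans.
by apply; lra.
Qed.

End leb_boxes.

Section lebesgue_measurability.
Context (R : realType) (n : nat).
Implicit Types (x v : 'rV[R]_n) (A U : set 'rV[R]_n).

Lemma leb_translate v A : leb [set x | A (x + v)] = leb A.
Proof.
suff le (w : 'rV[R]_n) (B : set 'rV[R]_n) :
    (leb [set x | B (x + w)%R] <= leb B)%E.
  apply/eqP; rewrite eq_le le/=; apply: le_trans (le (- v) _).
  by apply: leb_le => x Ax /=; rewrite addrNK.
apply: le_ereal_inf_tmp => _ [c Bc <-].
pose d k := if c k is Some ab then Some (ab.1 - w, ab.2 - w) else None.
have -> : (\sum_(k <oo) (box_volume (c k))%:E =
           \sum_(k <oo) (box_volume (d k))%:E)%E.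
  apply: eq_eseriesr => k _; rewrite /d; case: (c k) => [[a b]|]//=.
  by congr EFin; apply: eq_bigr => i _; rewrite !mxE; congr Num.max; ring.
apply: ereal_inf_lbound; exists d => // x /Bc[k _ ck]; exists k => //.
move: ck; rewrite /d; case: (c k) => [[a b]|]//= + i => /(_ i).
by rewrite !mxE; lra.
Qed.

(** Cutting an interval at t; the maxima keep the identity valid for empty intervals and for t
    outside of the interval. *)
Lemma max_sub_split (a b t : R) : Num.max 0 (b - a) =
  Num.max 0 (Num.min b t - a) + Num.max 0 (b - Num.max a t).
Proof.
have [bt|tb] := leP b t; have [ta|aT] := leP a t.
all: have [?|?] := leP 0 (b - a); have [?|?] := leP 0 (b - t);
  have [?|?] := leP 0 (t - a); lra.
Qed.

Definition row_upd v i (t : R) : 'rV[R]_n :=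
  \row_j if j == i then t else v 0 j.

Lemma row_updE v i t j : row_upd v i t 0 j = if j == i then t else v 0 j.
Proof. by rewrite mxE. Qed.

(** Each box of a cover is cut at height t without change of the total volume. Both halves are
    closed, and their overlap in the hyperplane costs nothing. This yields the Caratheodory
    criterion for coordinate half-spaces. *)
Lemma leb_split_coord A i (t : R) :
  (leb (A `&` [set x | x 0 i <= t]%R) + leb (A `&` [set x | t <= x 0 i]%R)
    <= leb A)%E.
Proof.
apply: le_ereal_inf_tmp => _ [c Ac <-].
pose lo k := if c k is Some ab then
  Some (ab.1, row_upd ab.2 i (Num.min (ab.2 0 i) t)) else None.
pose hi k := if c k is Some ab then
  Some (row_upd ab.1 i (Num.max (ab.1 0 i) t), ab.2) else None.
have -> : (\sum_(k <oo) (box_volume (c k))%:E =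
    \sum_(k <oo) ((box_volume (lo k))%:E + (box_volume (hi k))%:E))%E.
  apply: eq_eseriesr => k _; rewrite /lo /hi; case: (c k) => [[a b]|]/=;
    last by rewrite adde0.
  rewrite -EFinD; congr EFin; rewrite (bigD1 i)//= [in RHS](bigD1 i)//=.
  rewrite [X in _ = _ + X](bigD1 i)//= !row_updE eqxx.
  rewrite [X in _ = _ * X + _](eq_bigr (fun j => Num.max 0 (b 0 j - a 0 j)));
    last first.
    by move=> j ji; rewrite row_updE (negbTE ji).
  rewrite [X in _ = _ + _ * X](eq_bigr (fun j => Num.max 0 (b 0 j - a 0 j))).
    rewrite -mulrDl; congr (_ * _).
    exact: max_sub_split.
  by move=> j ji; rewrite row_updE (negbTE ji).
rewrite nneseriesD; try by move=> *; rewrite lee_fin box_volume_ge0.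
apply: leeD; apply: ereal_inf_lbound; [exists lo|exists hi] => //.
- move=> x [/Ac[k _ ck] /= xt]; exists k => //; move: ck; rewrite /lo.
  case: (c k) => [[a b]|]//= + j => /(_ j); rewrite row_updE.
  by case: eqVneq => // -> /andP[-> xb]; rewrite le_min xb.
- move=> x [/Ac[k _ ck] /= xt]; exists k => //; move: ck; rewrite /hi.
  case: (c k) => [[a b]|]//= + j => /(_ j); rewrite row_updE.
  by case: eqVneq => // -> /andP[xa ->]; rewrite ge_max xa xt.
Qed.

Notation T := (caratheodory_type (@leb R n)).

Lemma measurable_coord_le i (t : R) :
  measurable ([set x | x 0 i <= t] : set T).
Proof.
apply: le_caratheodory_measurable => A.
apply: le_trans (leb_split_coord A i t); rewrite leeD2l//; apply: leb_le.
by apply: setIS => x /= /negP; rewrite -ltNge => /ltW.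
Qed.

Lemma measurable_coord_ge i (t : R) :
  measurable ([set x | t <= x 0 i] : set T).
Proof.
apply: le_caratheodory_measurable => A.
rewrite addeC; apply: le_trans (leb_split_coord A i t); rewrite leeD2r//.
by apply: leb_le; apply: setIS => x /= /negP; rewrite -ltNge => /ltW.
Qed.

Lemma measurable_box c : measurable (box c : set T).
Proof.
case: c => [[a b]|]; last exact: measurable0.
rewrite (_ : box _ = \bigcap_(i : 'I_n) ([set x | a 0 i <= x 0 i] `&`
                                         [set x | x 0 i <= b 0 i])).
  apply: fin_bigcap_measurable => // i _; apply: measurableI.
    exact: measurable_coord_ge.
  exact: measurable_coord_le.
apply/seteqP; split => [x abx i _|x abx i]; first exact/andP/abx.
by apply/andP; exact: (abx i Logic.I).
Qed.

(** An open set is the union of the countably many cubes with rational centre and radius 1 / (k + 1)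
    that it contains. *)
Lemma open_measurable_leb U : open U -> measurable (U : set T).
Proof.
move=> oU.
pose F (qk : 'rV[rat]_n * nat) : set 'rV[R]_n :=
  let C := cube (map_mx ratr qk.1) qk.2.+1%:R^-1 in
  if `[< C `<=` U >] then C else set0.
rewrite (_ : U = \bigcup_qk F qk).
  apply: countable_bigcupT_measurable; first exact: countableP.
  by move=> qk; rewrite /F; case: ifPn => _; [exact: measurable_box|exact: measurable0].
apply/seteqP; split => [x Ux|x [qk _]]; last first.
  by rewrite /F; case: ifPn => // /asboolP; apply.
have /nbhs_ballP[e /= e0 eU] := open_nbhs_nbhs (conj oU Ux).
have [k] : exists k, 0 + k.+1%:R^-1 < e / 2 by apply: ltr_add_invr; lra.
rewrite add0r => ke.
have k0 : 0 < k.+1%:R^-1 :> R by rewrite invr_gt0.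
have near (d z p : R) : z - d < p < z + d -> `|z - p| <= d.
  by rewrite ler_norml; lra.
have [q xq] : {q : 'I_n -> rat & forall i, `|x 0 i - ratr (q i)| <= k.+1%:R^-1}.
  apply: (@choice _ _ (fun i q => `|x 0 i - ratr q| <= k.+1%:R^-1)) => i.
  have [|q] := @rat_in_itvoo _ (x 0 i - k.+1%:R^-1) (x 0 i + k.+1%:R^-1).
    by rewrite ltrD2l (lt_trans _ k0)// oppr_lt0.
  by rewrite in_itv/= => xq; exists q; exact: near.
have xqrow : `|x - map_mx ratr (\row_i q i)| <= k.+1%:R^-1.
  by apply/(row_norm_leP _ (ltW k0)) => i; rewrite !mxE.
exists (\row_i q i, k) => //; rewrite /F ifT.
  by rewrite cubeE ?ltW//= distrC.
apply/asboolP => y; rewrite cubeE ?(ltW k0)//= => qy; apply: eU.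
rewrite ball_rowE /=.
rewrite (le_lt_trans (ler_distD (map_mx ratr (\row_i q i)) _ _))//.
by apply: le_lt_trans (lerD xqrow qy) _; rewrite [e]splitr ltrD.
Qed.


End lebesgue_measurability.

(** * Hausdorff measure *)

Section hausdorff_theory.
Context (R : realType) (n : nat).
Implicit Types (F A B : set 'rV[R]_n) (d : R).

Lemma diam_ge0 F : (0 <= diam F)%E.
Proof. by rewrite /diam le_max lexx. Qed.

Lemma diam_le F d : 0 <= d ->
  (forall x y, F x -> F y -> enorm (x - y) <= d) -> (diam F <= d%:E)%E.
Proof.
move=> d0 Fd; rewrite /diam ge_max lee_fin d0/=.
by apply: ge_ereal_sup => _ [x Fx [y Fy <-]]; rewrite lee_fin Fd.
Qed.

Lemma enorm_le_diam F d x y : (diam F <= d%:E)%E -> F x -> F y ->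
  enorm (x - y) <= fine (diam F).
Proof.
move=> Fd Fx Fy.
have ffin : diam F \is a fin_num.
  by rewrite ge0_fin_numE ?diam_ge0// (le_lt_trans Fd)// ltry.
rewrite -lee_fin fineK// /diam le_max; apply/orP; right.
by apply: ereal_sup_ubound; exists x => //; exists y.
Qed.

Definition eball_volume (s : nat) : R := fine (leb (@eball R s 0 1)).

Lemma eball_volumeE s : leb (@eball R s 0 1) = (eball_volume s)%:E.
Proof.
rewrite fineK// ge0_fin_numE ?leb_ge0//.
apply: (@le_lt_trans _ _ (leb (ball (0 : 'rV[R]_s) 1))).
  apply: leb_le => x; rewrite /eball ball_rowE/= subr0 sub0r normrN.
  exact/le_lt_trans/norm_le_enorm.
by apply: le_lt_trans (leb_ball_le _ _) _ => //; rewrite ltry.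
Qed.

Lemma eball_volume_gt0 s : 0 < eball_volume s.
Proof.
rewrite -lte_fin -eball_volumeE.
(* A sup norm ball of radius 1 / (s + 1) lies in the Euclidean unit ball; s + 1 in place of s makes
   the inequality strict and covers s = 0. *)
have s0 : 0 < (s.+1%:R^-1 : R) by rewrite invr_gt0.
apply: (@lt_le_trans _ _ ((s.+1%:R^-1 : R) ^+ s)%:E).
  by rewrite lte_fin exprn_gt0.
apply: le_trans (leb_ball_ge (0 : 'rV[R]_s) s0) _; apply: leb_le => x.
rewrite ball_rowE /eball/= subr0 sub0r normrN => xs.
apply: le_lt_trans (enorm_le_norm _) _.
apply: (@le_lt_trans _ _ (s%:R * s.+1%:R^-1)).
  by rewrite ler_wpM2l// ltW.
by rewrite ltr_pdivrMr// mul1r ltr_nat.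
Qed.

Lemma hausdorff_weightE s F : hausdorff_weight s F =
  (eball_volume s * (fine (diam F) / 2) ^+ s)%:E.
Proof. by rewrite /hausdorff_weight eball_volumeE EFinM. Qed.

Lemma hausdorff_weight_ge0 s F : (0 <= hausdorff_weight s F)%E.
Proof.
rewrite hausdorff_weightE lee_fin mulr_ge0 ?(ltW (eball_volume_gt0 s))//.
by rewrite exprn_ge0// divr_ge0// fine_ge0// diam_ge0.
Qed.

Lemma diam_set0 : diam (@set0 'rV[R]_n) = 0%E.
Proof. by apply/eqP; rewrite eq_le diam_ge0 andbT; apply: diam_le. Qed.

Lemma hausdorff_weight_set0 s : (0 < s)%N ->
  hausdorff_weight s (@set0 'rV[R]_n) = 0%E.
Proof.
move=> s0; rewrite hausdorff_weightE diam_set0/= mul0r expr0n.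
by rewrite gtn_eqF// mulr0.
Qed.

Lemma hausdorff_deltaE s d A : hausdorff_delta s d A =
  cover_cost [set F | diam F <= d%:E]%E id (@hausdorff_weight R n s) A.
Proof. by []. Qed.

Lemma hausdorff_delta_le s d A : 0 < d -> (hausdorff_delta s d A <= hausdorff s A)%E.
Proof. by move=> d0; apply: ereal_sup_ubound; exists d. Qed.

Lemma hausdorff_le_delta s A v :
  (forall d, 0 < d -> (hausdorff_delta s d A <= v)%E) -> (hausdorff s A <= v)%E.
Proof. by move=> Av; apply: ge_ereal_sup => _ [d d0 <-]; exact: Av. Qed.

Lemma hausdorff_delta_anti s d d' A : d' <= d ->
  (hausdorff_delta s d A <= hausdorff_delta s d' A)%E.
Proof.
move=> dd'; apply/ereal_inf_le_tmp => _ [F [Fd AF] <-]; exists F => //.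
by split => // k; apply: le_trans (Fd k) _; rewrite lee_fin.
Qed.

Lemma hausdorff_ge0 s A : (0 <= hausdorff s A)%E.
Proof.
apply: le_trans (hausdorff_delta_le _ _ ltr01).
by rewrite hausdorff_deltaE; apply: cover_cost_ge0 => F; exact: hausdorff_weight_ge0.
Qed.

Lemma le_hausdorff s A B : A `<=` B -> (hausdorff s A <= hausdorff s B)%E.
Proof.
move=> AB; apply: hausdorff_le_delta => d d0.
by apply: le_trans (hausdorff_delta_le _ _ d0); rewrite !hausdorff_deltaE le_cover_cost.
Qed.

Lemma hausdorff_set0 s : (0 < s)%N -> hausdorff s (@set0 'rV[R]_n) = 0%E.
Proof.
move=> s0; apply/eqP; rewrite eq_le hausdorff_ge0 andbT.
apply: hausdorff_le_delta => d d0; apply: ereal_inf_lbound; exists (fun=> set0).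
  by split => // _; rewrite diam_set0 lee_fin ltW.
by apply: eseries0 => k _ _; exact: hausdorff_weight_set0.
Qed.

Lemma hausdorff_sigma_subadditive s : sigma_subadditive (@hausdorff R n s).
Proof.
move=> A; apply: hausdorff_le_delta => d d0.
apply: le_trans (@cover_cost_sigma_subadditive _ _ _
  [set F | diam F <= d%:E]%E id _ (hausdorff_weight_ge0 s) A) _.
apply: lee_nneseries => k _; last exact: hausdorff_delta_le.
by move=> _; apply: cover_cost_ge0 => F; exact: hausdorff_weight_ge0.
Qed.

(** The sequence A, B is continued by empty sets, whose weight vanishes only for positive s. *)
Lemma hausdorffU s A B : (0 < s)%N ->
  (hausdorff s (A `|` B) <= hausdorff s A + hausdorff s B)%E.
Proof.
move=> s0; pose S (k : nat) := if k == 0%N then A else if k == 1%N then B else set0.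
have -> : A `|` B = \bigcup_k S k.
  apply/seteqP; split => [x [Ax|Bx]|x [[|[|k]] _ //]]; last 2 first.
  - by left.
  - by right.
  - by exists 0%N.
  - by exists 1%N.
apply: le_trans (@hausdorff_sigma_subadditive s S) _.
rewrite (nneseries_split 0 2); last by move=> k _; exact: hausdorff_ge0.
rewrite add0n big_nat_recr//= big_nat1 eseries0 ?adde0// => -[|[|k]]// _ _.
exact: hausdorff_set0.
Qed.

(** With g the diameter of a covering set and e the added margin, (g + e)^s is at most 2^s (g^s +
    e^s). The factor 2^s / [eball_volume s] turns weights into powers g^s, and the summand 1 pays
    for the margins. *)
Definition hausdorff_cover_const (s : nat) : R :=
  2 ^+ s * (2 ^+ s / eball_volume s + 1).

Lemma hausdorff_cover_const_gt0 s : 0 < hausdorff_cover_const s.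
Proof.
by rewrite mulr_gt0 ?exprn_gt0// addr_gt0// divr_gt0 ?exprn_gt0// eball_volume_gt0.
Qed.

(** Each covering set is put into a ball around one of its points, with radius slightly larger than
    its diameter; the margin keeps the radius positive for singletons and for empty members. *)
Lemma hausdorff_ball_cover s A (y d : R) : (0 < s)%N -> 0 < d ->
  (hausdorff s A < y%:E)%E ->
  exists (x : nat -> 'rV[R]_n) (r : nat -> R),
    [/\ forall k, 0 < r k <= d, A `<=` \bigcup_k ball (x k) (r k) &
        (\sum_(k <oo) (r k ^+ s)%:E <= (hausdorff_cover_const s * y)%:E)%E].
Proof.
move=> s0 d0 Ay.
have y0 : 0 < y by rewrite -lte_fin (le_lt_trans (hausdorff_ge0 _ _) Ay).
have d20 : 0 < d / 2 by rewrite divr_gt0.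
have := le_lt_trans (hausdorff_delta_le s A d20) Ay.
rewrite hausdorff_deltaE => /cover_cost_lt[F [Fd AF Fy]].
pose g k := fine (diam (F k)).
have g0 k : 0 <= g k by rewrite fine_ge0// diam_ge0.
have gd k : g k <= d / 2.
  have := Fd k; rewrite -lee_fin /g => /= h; rewrite fineK//.
  by rewrite ge0_fin_numE ?diam_ge0// (le_lt_trans h)// ltry.
(* The bound d / 2 keeps the radii below d, the bound 1 gives e^s <= e, and the bound y makes the
   margins sum to at most y. *)
pose m := Num.min (d / 2) (Num.min 1 y).
have m0 : 0 < m by rewrite !lt_min d20 ltr01.
pose e k := m / (2 ^ k.+1)%:R.
have e0 k : 0 < e k by rewrite divr_gt0// ltr0n expn_gt0.
have em k : e k <= m.
  by rewrite ler_pdivrMr ?ltr0n ?expn_gt0// ler_peMr ?(ltW m0)// ler1n expn_gt0.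
have [x xF] : {x : nat -> 'rV[R]_n & forall k, F k !=set0 -> F k (x k)}.
  apply: (@choice _ _ (fun k x => F k !=set0 -> F k x)) => k.
  by have [[x Fx]|] := pselect (F k !=set0); [exists x|exists 0].
exists x, (fun k => g k + e k); split.
- move=> k; rewrite ltr_wpDl//= [leRHS]splitr lerD//.
  by apply: le_trans (em k) _; rewrite ge_min lexx.
- move=> z /AF[k _ Fkz]; exists k => //; rewrite ball_rowE/=.
  have Fx : F k (x k) by apply: xF; exists z.
  apply: le_lt_trans (norm_le_enorm _) _.
  by apply: le_lt_trans (enorm_le_diam (Fd k) Fx Fkz) _; rewrite ltrDl.
have ek1 k : e k ^+ s <= y / (2 ^ k.+1)%:R.
  apply: (@le_trans _ _ (e k)).
    rewrite -[leRHS]expr1 ler_wiXn2l// ?(ltW (e0 k))//.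
    by apply: le_trans (em k) _; rewrite !ge_min lexx orbT.
  by rewrite ler_wpM2r ?invr_ge0// !ge_min lexx !orbT.
have vol0 := eball_volume_gt0 s.
have gw k : g k ^+ s = 2 ^+ s / eball_volume s * fine (hausdorff_weight s (F k)).
  rewrite hausdorff_weightE/= -/(g k) expr_div_n; field.
  by rewrite expf_neq0//= gt_eqF.
(* The summand [0 + _] has the shape of [epsilon_trick] for the zero sequence, which sums the
   margins at the end. *)
apply: (@le_trans _ _ (\sum_(k <oo) ((2 ^+ s)%:E *
    ((2 ^+ s / eball_volume s)%:E * hausdorff_weight s (F k) +
    (0 + (y / (2 ^ k.+1)%:R)%:E))))%E).
  apply: lee_nneseries => [k _ _|k _].
    by rewrite lee_fin exprn_ge0// addr_ge0// ltW.
  have -> : hausdorff_weight s (F k) = (fine (hausdorff_weight s (F k)))%:E.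
    by rewrite hausdorff_weightE.
  rewrite add0e -EFinM -gw lee_fin.
  apply: (@le_trans _ _ (2 ^+ s * (g k ^+ s + e k ^+ s))); last first.
    by rewrite ler_wpM2l ?exprn_ge0// lerD2l.
  have mx_ge0 : 0 <= Num.max (g k) (e k) by rewrite le_max g0.
  apply: (@le_trans _ _ ((2 * Num.max (g k) (e k)) ^+ s)).
    rewrite lerXn2r ?nnegrE ?mulr_ge0// ?addr_ge0// ?(ltW (e0 k))//.
    by rewrite mulr_natl mulr2n lerD// le_max lexx ?orbT.
  rewrite exprMn ler_wpM2l ?exprn_ge0//.
  by have [_|_] := leP (g k) (e k); rewrite ?lerDl ?lerDr exprn_ge0// ltW.
have t1 k : (0 <= (2 ^+ s / eball_volume s)%:E * hausdorff_weight s (F k))%E.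
  rewrite mule_ge0 ?hausdorff_weight_ge0//.
  by rewrite lee_fin divr_ge0 ?exprn_ge0// ltW.
have t2 k : (0 <= 0 + (y / (2 ^ k.+1)%:R)%:E)%E.
  by rewrite add0e lee_fin divr_ge0// ltW.
rewrite nneseriesZl; last by move=> k _; exact: adde_ge0.
have -> : hausdorff_cover_const s * y =
  2 ^+ s * ((2 ^+ s / eball_volume s + 1) * y) by rewrite mulrA.
rewrite [leRHS]EFinM lee_wpmul2l ?lee_fin ?exprn_ge0//.
rewrite nneseriesD//.
rewrite mulrDl EFinD mul1r leeD//.
  rewrite nneseriesZl; last by move=> *; exact: hausdorff_weight_ge0.
   rewrite [leRHS]EFinM lee_wpmul2l ?(ltW Fy)//.
  by rewrite lee_fin divr_ge0 ?exprn_ge0// ltW.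
have := @epsilon_trick R (fun=> 0%E) y xpredT (fun=> lexx _) (ltW y0).
by rewrite [X in (_ <= X + _)%E -> _]eseries0// add0e.
Qed.

End hausdorff_theory.

Section separated_sets.
Context (R : realType) (n s : nat).
Implicit Types (F A B : set 'rV[R]_n) (d : R).
Hypothesis s0 : (0 < s)%N.

(** A set of diameter at most d cannot meet both A and B, so every admissible cover of the union
    splits into covers of the two parts. No measurability is involved. *)
Lemma hausdorff_delta_separated d A B :
  (forall x y, A x -> B y -> d < `|x - y|) ->
  (hausdorff_delta s d A + hausdorff_delta s d B <= hausdorff_delta s d (A `|` B))%E.
Proof.
move=> sep; apply: le_ereal_inf_tmp => _ [F [Fd ABF] <-].
pose G C k := if `[< F k `&` C !=set0 >] then F k else set0.
have GC C : C `<=` \bigcup_k F k ->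
    (hausdorff_delta s d C <= \sum_(k <oo) hausdorff_weight s (G C k))%E.
  move=> CF; apply: ereal_inf_lbound; exists (G C) => //; split.
    move=> k; rewrite /G; case: ifP => // _; rewrite diam_set0.
    exact: le_trans (diam_ge0 _) (Fd k).
  move=> x Cx; have [k _ Fx] := CF x Cx; exists k => //; rewrite /G ifT//.
  by apply/asboolP; exists x.
apply: (@le_trans _ _ (\sum_(k <oo) hausdorff_weight s (G A k) +
                       \sum_(k <oo) hausdorff_weight s (G B k))%E).
  by apply: leeD; apply: GC => x ABx; apply: ABF; [left|right].
rewrite -nneseriesD; try by move=> *; exact: hausdorff_weight_ge0.
apply: lee_nneseries => [k _ _|k _].
  by rewrite adde_ge0// hausdorff_weight_ge0.
rewrite /G; case: ifPn => [/asboolP[x [Fx Ax]]|_]; last first.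
  rewrite hausdorff_weight_set0// add0e; case: ifPn => // _.
  by rewrite hausdorff_weight_set0// hausdorff_weight_ge0.
case: ifPn => [/asboolP[y [Fy By]]|_]; last by rewrite hausdorff_weight_set0// adde0.
exfalso; have := sep _ _ Ax By; apply/negP; rewrite -leNgt.
apply: le_trans (norm_le_enorm _) _; rewrite -lee_fin.
apply: le_trans (Fd k); rewrite /diam le_max; apply/orP; right.
by apply: ereal_sup_ubound; exists x => //; exists y.
Qed.

(** A point within d < r i of the ball of radius r i lies in the doubled ball. Disjointness of the
    doubled balls thus separates the original ones by more than d. *)
Lemma hausdorff_delta_disjoint_balls (I : eqType) (S : set 'rV[R]_n)
    (c : I -> 'rV[R]_n) (r : I -> R) (d : R) (u : seq I) :
  uniq u ->
  (forall i, i \in u -> d < r i) ->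
  (forall i j, i \in u -> j \in u -> i != j ->
    ball (c i) (2 * r i) `&` ball (c j) (2 * r j) = set0) ->
  (\sum_(i <- u) hausdorff_delta s d (S `&` ball (c i) (r i)) <=
   hausdorff_delta s d (S `&` \bigcup_(i in [set` u]) ball (c i) (r i)))%E.
Proof.
elim: u => [_ _ _|i u IH /= /andP[iu uu] ur disj].
  rewrite big_nil hausdorff_deltaE; apply: cover_cost_ge0.
  exact: hausdorff_weight_ge0.
rewrite big_cons; apply: (@le_trans _ _ (
   hausdorff_delta s d (S `&` ball (c i) (r i)) +
   hausdorff_delta s d (S `&` \bigcup_(i in [set` u]) ball (c i) (r i)))%E).
  rewrite leeD2l// IH// => [j ju|j k ju ku]; first by apply: ur; rewrite inE ju orbT.
  by apply: disj; rewrite inE ?ju ?ku orbT.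
apply: le_trans (hausdorff_delta_separated _) _ => [x y [_ xi] [_ [j ju yj]]|].
  rewrite ltNge; apply/negP => xyd.
  have ij : i != j by apply: contraNneq iu => ->.
  have := disj i j; rewrite !inE eqxx ju orbT => /(_ isT isT ij).
  move=> /seteqP[+ _] => /(_ y); apply; move: xi yj; rewrite !ball_rowE/= => xi yj.
  split; last first.
    have rj0 : 0 < r j := le_lt_trans (normr_ge0 _) yj.
    by apply: lt_le_trans yj _; rewrite ler_peMl ?ler1n// ltW.
  rewrite (_ : c i - y = (c i - x) + (x - y)); last by rewrite addrA subrK.
  apply: le_lt_trans (ler_normD _ _) _; rewrite mulr_natl mulr2n.
  by rewrite ltr_leD// (le_trans xyd)// ltW// ur// mem_head.
rewrite !hausdorff_deltaE; apply: le_cover_cost => x [[Sx xi]|[Sx [j ju xj]]]; split => //.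
  by exists i => //=; rewrite mem_head.
by exists j => //=; rewrite inE ju orbT.
Qed.

Lemma hausdorff_disjoint_balls (I : eqType) (S : set 'rV[R]_n)
    (c : I -> 'rV[R]_n) (r a : I -> R) (u : seq I) :
  uniq u ->
  (forall i, i \in u -> 0 < r i) ->
  (forall i j, i \in u -> j \in u -> i != j ->
    ball (c i) (2 * r i) `&` ball (c j) (2 * r j) = set0) ->
  (forall i, i \in u -> (a i)%:E < hausdorff s (S `&` ball (c i) (r i)))%E ->
  ((\sum_(i <- u) a i)%:E <= hausdorff s S)%E.
Proof.
move=> uu r0 disj ua.
(* Since the family is finite and [hausdorff_delta] grows as the scale shrinks, a single scale below
   all radii witnesses all the strict lower bounds. *)
have [d [d0 dr da]] : exists d, [/\ 0 < d, forall i, i \in u -> d < r i &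
    forall i, i \in u -> ((a i)%:E < hausdorff_delta s d (S `&` ball (c i) (r i)))%E].
  elim: u {uu disj} r0 ua => [_ _|i u IH r0 ua]; first by exists 1; split.
  have [||d [d0 dr da]] := IH.
  - by move=> j ju; apply: r0; rewrite inE ju orbT.
  - by move=> j ju; apply: ua; rewrite inE ju orbT.
  have /ereal_sup_gt[_ [e e0 <-] ae] := ua i (mem_head _ _).
  have ri : 0 < r i / 2 by rewrite divr_gt0// r0// mem_head.
  exists (Num.min d (Num.min e (r i / 2))); split.
  - by rewrite !lt_min d0 ri andbT.
  - move=> j; rewrite inE => /predU1P[->|/dr]; rewrite !gt_min.
      by rewrite [X in [|| _, _ | X]](_ : _ = true) ?orbT//; lra.
    by move=> ->.
  - move=> j; rewrite inE => /predU1P[->|/da].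
      move/lt_le_trans: ae; apply; apply: hausdorff_delta_anti.
      by rewrite !ge_min lexx !orbT.
    move/lt_le_trans; apply; apply: hausdorff_delta_anti.
    by rewrite !ge_min lexx.
apply: le_trans (le_trans (hausdorff_delta_disjoint_balls S uu dr disj) _).
  by rewrite -sumEFin big_seq [leRHS]big_seq; apply: lee_sum => i /da /ltW.
apply: le_trans (hausdorff_delta_le _ _ d0) _; apply: le_hausdorff.
exact: subIsetl.
Qed.

End separated_sets.

(** Balls of radius at most d have total volume at most a constant times d times the sum of the
    r^(n+1), and d is arbitrary. *)
Lemma leb_null_of_hausdorff (R : realType) (n : nat) (A : set 'rV[R]_n.+2) :
  (hausdorff n.+1 A < +oo)%E -> leb A = 0%E.
Proof.
move=> Aoo.
have Hfin : hausdorff n.+1 A \is a fin_num.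
  by rewrite ge0_fin_numE ?hausdorff_ge0.
pose y := fine (hausdorff n.+1 A) + 1.
have Ay : (hausdorff n.+1 A < y%:E)%E.
  by rewrite -(fineK Hfin) lte_fin ltrDl.
have y0 : 0 <= y by rewrite addr_ge0// fine_ge0// hausdorff_ge0.
pose K := 2 ^+ n.+2 * (hausdorff_cover_const R n.+1 * y).
have K0 : 0 <= K.
  by rewrite mulr_ge0 ?exprn_ge0// mulr_ge0// ltW// hausdorff_cover_const_gt0.
apply/eqP; rewrite eq_le leb_ge0 andbT; apply/lee_addgt0Pr => e e0.
rewrite add0e.
have d0 : 0 < e / (K + 1) by rewrite divr_gt0// ltr_wpDl.
have [//|x [r [rd Ar rsum]]] := hausdorff_ball_cover _ d0 Ay.
apply: le_trans (leb_le Ar) _; apply: le_trans (leb_sigma_subadditive _) _.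
apply: (@le_trans _ _ (\sum_(k <oo) ((e / (K + 1) * 2 ^+ n.+2)%:E * (r k ^+ n.+1)%:E))%E).
  apply: lee_nneseries => [k _ _|k _]; first exact: leb_ge0.
  have /andP[r0 rk] := rd k.
  apply: le_trans (leb_ball_le _ (ltW r0)) _.
  rewrite -EFinM lee_fin exprMn.
  rewrite (_ : _ * _ * r k ^+ n.+1 = 2 ^+ n.+2 * (e / (K + 1) * r k ^+ n.+1));
    last by ring.
  rewrite ler_wpM2l ?exprn_ge0//.
  by rewrite exprS ler_wpM2r// exprn_ge0// ltW.
rewrite nneseriesZl; last by move=> k _; rewrite lee_fin exprn_ge0// ltW//; case/andP: (rd k).
apply: (@le_trans _ _ ((e / (K + 1) * 2 ^+ n.+2)%:E * (hausdorff_cover_const R n.+1 * y)%:E)%E).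
  by rewrite lee_wpmul2l// lee_fin mulr_ge0 ?exprn_ge0 ?(ltW d0).
rewrite -EFinM lee_fin.
have -> : e / (K + 1) * 2 ^+ n.+2 * (hausdorff_cover_const R n.+1 * y) =
    e / (K + 1) * K by rewrite /K; ring.
by rewrite mulrAC ler_pdivrMr ?ltr_wpDl// ler_pM2l// lerDl.
Qed.

(** * Slicing by spheres *)

Lemma cover_cost_seq (R : realType) (T I : Type) (adm : set I)
    (S : I -> set T) (w : I -> \bar R) (i0 : I) (u : seq I) (A : set T) :
  (forall i, (0 <= w i)%E) -> adm i0 -> w i0 = 0%E ->
  (forall k, (k < size u)%N -> adm (nth i0 u k)) ->
  (forall x, A x -> exists2 k, (k < size u)%N & S (nth i0 u k) x) ->
  (cover_cost adm S w A <= \sum_(i <- u) w i)%E.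
Proof.
move=> w0 adm0 wi0 uadm Au.
apply: (@le_trans _ _ (\sum_(k <oo) w (nth i0 u k))%E).
  apply: ereal_inf_lbound; exists (nth i0 u) => //; split => [k|x Ax].
    by have [/uadm//|uk] := ltnP k (size u); rewrite nth_default.
  by have [k _ Sx] := Au x Ax; exists k.
rewrite (nneseries_split 0 (size u)); last by move=> k _; exact: w0.
rewrite add0n -(big_nth i0 xpredT w) eseries_cond eseries0 ?adde0// => k _.
by rewrite /= => uk; rewrite nth_default.
Qed.

Section small_cubes.
Context (R : realType) (n : nat).
Let N := n.+1.

(** Slicing needs covers whose members have volume comparable to a power of their diameter, which
    long thin boxes violate. The absolute value makes the cost nonnegative for every index,
    admissible or not. *)
Definition cube_cost (d : R) : set 'rV[R]_N -> \bar R :=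
  cover_cost [set c : 'rV[R]_N * R | 0 <= c.2 <= d] (fun c => cube c.1 c.2)
    (fun c => ((2 * `|c.2|) ^+ N)%:E).

(** The product is a polynomial in t with value [box_volume c] at 0. It bounds the total volume of
    the cells of mesh t needed to cover the box. *)
Lemma box_volume_fatten (c : option ('rV[R]_N * 'rV[R]_N)) (d e : R) :
  0 < d -> 0 < e ->
  exists2 t : R, 0 < t <= d &
    if c is Some ab then
      \prod_(i < N) (Num.max 0 (ab.2 0 i - ab.1 0 i) + t) <= box_volume c + e
    else True.
Proof.
case: c => [[a b]|] d0 e0; last by exists d; rewrite ?d0 ?lexx.
pose p := \prod_(i < N) ((Num.max 0 (b 0 i - a 0 i))%:P + 'X).
have pE t : p.[t] = \prod_(i < N) (Num.max 0 (b 0 i - a 0 i) + t).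
  by rewrite horner_prod; apply: eq_bigr => i _; rewrite hornerD hornerC hornerX.
have p0 : p.[0] = box_volume (Some (a, b)).
  by rewrite pE; apply: eq_bigr => i _; rewrite addr0.
have : \forall t \near 0, `|p.[0] - p.[t]| < e.
  by have /cvgrPdist_lt/(_ e e0) := @continuous_horner R p 0.
move=> /nbhs_ballP[r /= r0 rp].
exists (Num.min d (r / 2)); first by rewrite lt_min d0 divr_gt0//= ge_min lexx.
rewrite /= -/(box_volume (Some (a, b))) -pE -p0.
have := rp (Num.min d (r / 2)); rewrite -ball_normE/= sub0r normrN.
rewrite ger0_norm ?le_min ?(ltW d0) ?divr_ge0 ?(ltW r0)//.
rewrite gt_min [r / 2 < r]ltr_pdivrMr// ltr_pMr// ltr1n orbT => /(_ isT).
rewrite ltr_norml => /andP[h _]; lra.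
Qed.

Lemma cube_cost_box (d : R) c : 0 < d -> (cube_cost d (box c) <= (box_volume c)%:E)%E.
Proof.
move=> d0.
have w0 (i : 'rV[R]_N * R) : (0 <= ((2 * `|i.2|) ^+ N)%:E)%E.
  by rewrite lee_fin exprn_ge0// mulr_ge0.
have i0w : ((2 * `|(0 : 'rV[R]_N, 0 : R).2|) ^+ N)%:E = 0%E.
  by rewrite /= normr0 mulr0 expr0n.
have i0adm : [set c : 'rV[R]_N * R | 0 <= c.2 <= d] (0, 0).
  by rewrite /= lexx ltW.
case: c => [[a b]|]; last first.
  apply: le_trans (@cover_cost_seq _ _ _ _ _ _ (0, 0) [::] _ w0 i0adm i0w _ _) _ => //.
  by rewrite big_nil.
apply/lee_addgt0Pr => e e0.
have [t /andP[t0 td] vol] := box_volume_fatten (Some (a, b)) d0 e0.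
have [abn|abn] := pselect (exists i, b 0 i < a 0 i).
  have [i ba] := abn.
  apply: le_trans (@cover_cost_seq _ _ _ _ _ _ (0, 0) [::] _ w0 i0adm i0w _ _) _ => //.
    by move=> x /(_ i); rewrite /=; lra.
  by rewrite big_nil -EFinD lee_fin addr_ge0 ?box_volume_ge0// ltW.
have ab i : 0 <= b 0 i - a 0 i.
  by rewrite subr_ge0 leNgt; apply/negP => ba; apply: abn; exists i.
(* The number of grid cells in direction i; the successor covers the right end point, at the cost of
   at most t in length. *)
pose m i := (Num.trunc ((b 0 i - a 0 i) / t)).+1.
(* A common bound, so that the cells are indexed by functions into one ordinal type, cut down to the
   true counts by [Q]. *)
pose M := (\max_i m i)%N.
have mM i : (m i <= M)%N by exact: (leq_bigmax i).
pose Q (i : 'I_N) : pred 'I_M := fun j => (j < m i)%N.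
pose code (f : {ffun 'I_N -> 'I_M}) : 'rV[R]_N * R :=
  (\row_i (a 0 i + ((f i)%:R + 2^-1) * t), t / 2).
pose u := map code (enum [pred f | f \in family Q]).
apply: le_trans (@cover_cost_seq _ _ _ _ _ _ (0, 0) u _ w0 i0adm i0w _ _) _.
- move=> k ku; have /mapP[f _ ->] : nth (0, 0) u k \in u by rewrite mem_nth.
  by rewrite /= divr_ge0 ?(ltW t0)//=; lra.
- move=> x abx.
  have fP i : (Num.trunc ((x 0 i - a 0 i) / t)%R < m i)%N.
    rewrite ltnS; apply: le_truncn; rewrite ler_pM2r ?invr_gt0//.
    by have := abx i; rewrite /=; lra.
  pose f := [ffun i => Ordinal (leq_trans (fP i) (mM i))].
  have fu : code f \in u.
    apply: map_f; rewrite mem_enum inE; apply/familyP => i.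
    by rewrite ffunE /Q unfold_in /= fP.
  exists (index (code f) u); first by rewrite index_mem.
  rewrite nth_index//= => i; rewrite /= !mxE ffunE /=.
  have xa : 0 <= (x 0 i - a 0 i) / t.
    by rewrite divr_ge0 ?(ltW t0)//; have := abx i; rewrite /=; lra.
  have := truncn_itv xa; rewrite ler_pdivlMr// ltr_pdivrMr//.
  rewrite -natr1; set z := _%:R; nra.
rewrite big_map big_enum /=.
under eq_bigr do rewrite ger0_norm ?divr_ge0 ?(ltW t0)//.
have -> : 2 * (t / 2) = t by field.
apply: (@le_trans _ _ (\prod_(i < N) (Num.max 0 (b 0 i - a 0 i) + t))%:E); last first.
  by rewrite -EFinD lee_fin.
rewrite sumEFin lee_fin.
have -> : \sum_(f in family Q) t ^+ N = \prod_(i < N) \sum_(j | Q i j) t.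
  rewrite bigA_distr_big_dep; apply: eq_bigr => f _.
  by rewrite prodr_const card_ord.
apply: ler_prod => i _; rewrite sumr_ge0 => [|j _]; last exact: ltW.
rewrite -(big_ord_widen M (fun=> t) (mM i)) sumr_const card_ord max_r//.
have /truncn_itv/andP[h _] : 0 <= (b 0 i - a 0 i) / t by rewrite divr_ge0// ltW.
move: h; rewrite ler_pdivlMr// => h.
by rewrite /m -mulr_natl -natr1 mulrDl mul1r lerD2r.
Qed.

Lemma small_cube_cover (A : set 'rV[R]_N) (v d : R) : 0 < d ->
  (leb A < v%:E)%E ->
  exists (z : nat -> 'rV[R]_N) (r : nat -> R),
    [/\ forall k, 0 <= r k <= d, A `<=` \bigcup_k cube (z k) (r k) &
        (\sum_(k <oo) ((2 * r k) ^+ N)%:E < v%:E)%E].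
Proof.
move=> d0 Av.
have w0 (i : 'rV[R]_N * R) : (0 <= ((2 * `|i.2|) ^+ N)%:E)%E.
  by rewrite lee_fin exprn_ge0// mulr_ge0.
have : (cube_cost d A < v%:E)%E.
  have /ereal_inf_lt[_ [c Ac <-]] := Av; apply: le_lt_trans.
  apply: le_trans (le_cover_cost _ _ _ Ac) _.
  apply: le_trans (cover_cost_sigma_subadditive _ _ w0 _) _.
  apply: lee_nneseries => k _; last exact: cube_cost_box.
  by move=> _; apply: cover_cost_ge0.
move=> /cover_cost_lt[c [cd Ac cv]].
exists (fun k => (c k).1), (fun k => (c k).2); split => //.
rewrite (eq_eseriesr (g := fun k => ((2 * `|(c k).2|) ^+ N)%:E))// => k _.
by rewrite ger0_norm//; case/andP: (cd k).
Qed.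

End small_cubes.

Lemma limn_einf_ge (R : realType) (u : nat -> \bar R) (l : \bar R) m0 :
  (forall m, (m0 <= m)%N -> l <= u m)%E -> (l <= limn_einf u)%E.
Proof.
move=> lu; rewrite limn_einf_lim.
apply: (@le_trans _ _ (einfs u m0)).
  by apply: le_ereal_inf_tmp => _ [m /= m0m <-]; exact: lu.
rewrite (cvg_lim _ (ereal_nondecreasing_cvgn (nondecreasing_einfs u)))//.
by apply: ereal_sup_ubound; exists m0.
Qed.

Lemma limn_einf_le (R : realType) (u : nat -> \bar R) (l : \bar R) :
  (forall m, u m <= l)%E -> (limn_einf u <= l)%E.
Proof.
move=> ul; rewrite limn_einf_lim; apply: lime_le; first exact: is_cvg_einfs.
apply: nearW => m; apply: le_trans (ul m).
by apply: ereal_inf_lbound; exists m => /=.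
Qed.

Section slicing.
Context (R : realType) (n : nat).
Let N := n.+2.
Notation mu := (@lebesgue_measure R).

(** A cube of radius r has Euclidean diameter at most 2 N r, which gives the bracket. The factor 2
    is slack: the mean over the slices is at most half of the claimed bound, so they cannot all
    exceed it. *)
Definition slice_const : R := 2 * (eball_volume R n.+1 * N%:R ^+ n.+1).

Lemma slice_const_gt0 : 0 < slice_const.
Proof. by rewrite !mulr_gt0 ?eball_volume_gt0// exprn_gt0. Qed.

Lemma diam_cube (z : 'rV[R]_N) (r : R) : 0 <= r ->
  (diam (cube z r) <= (2 * (N%:R * r))%:E)%E.
Proof.
move=> r0; apply: diam_le => [|x y]; first by rewrite !mulr_ge0.
rewrite cubeE//= => zx zy; apply: le_trans (enorm_le_norm _) _.
rewrite [leRHS]mulrCA ler_wpM2l//.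
apply: le_trans (ler_distD z _ _) _.
by rewrite mulr_natl mulr2n lerD// distrC.
Qed.

Lemma hausdorff_weight_cube (z : 'rV[R]_N) (r : R) : 0 <= r ->
  (hausdorff_weight n.+1 (cube z r) <= (eball_volume R n.+1 * (N%:R * r) ^+ n.+1)%:E)%E.
Proof.
move=> r0; rewrite hausdorff_weightE lee_fin ler_wpM2l//.
  exact/ltW/eball_volume_gt0.
rewrite lerXn2r ?nnegrE ?divr_ge0 ?mulr_ge0// ?fine_ge0 ?diam_ge0//.
rewrite ler_pdivrMr// mulrC -lee_fin fineK ?diam_cube//.
by rewrite ge0_fin_numE ?diam_ge0// (le_lt_trans (diam_cube _ _))// ltry.
Qed.

(* Eilenberg's inequality for the distance to x; the multiplicities of a cover
   by small cubes are integrated over the interval, and Fatou's lemma applies. *)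
Lemma good_slice (S : set 'rV[R]_N) (x : 'rV[R]_N) (v a b : R) :
  (leb S < v%:E)%E -> 0 < v -> a < b ->
  exists2 t, a < t < b &
    (hausdorff n.+1 (S `&` [set y | `|x - y| = t]%R) <=
     (slice_const * v / (b - a))%:E)%E.
Proof.
move=> Sv v0 ab; apply: contrapT => none.
have none' t : a < t < b -> ((slice_const * v / (b - a))%:E <
    hausdorff n.+1 (S `&` [set y | `|x - y| = t]%R))%E.
  by move=> atb; rewrite ltNge; apply/negP => h; apply: none; exists t.
have dm0 (m : nat) : 0 < (m.+1%:R^-1 : R) by rewrite invr_gt0.
have [zr zrP] : {zr : nat -> (nat -> 'rV[R]_N) * (nat -> R) & forall m,
    [/\ forall k, 0 <= (zr m).2 k <= m.+1%:R^-1,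
        S `<=` \bigcup_k cube ((zr m).1 k) ((zr m).2 k) &
        (\sum_(k <oo) ((2 * (zr m).2 k) ^+ N)%:E < v%:E)%E]}.
  apply: (@choice _ _ (fun m zr => [/\ forall k, 0 <= zr.2 k <= m.+1%:R^-1,
        S `<=` \bigcup_k cube (zr.1 k) (zr.2 k) &
        (\sum_(k <oo) ((2 * zr.2 k) ^+ N)%:E < v%:E)%E])) => m.
  by have [z [r zr]] := small_cube_cover (dm0 m) Sv; exists (z, r).
pose z m := (zr m).1; pose r m := (zr m).2.
have r0 m k : 0 <= r m k by have [/(_ k)/andP[]] := zrP m.
pose w m k := eball_volume R n.+1 * (N%:R * r m k) ^+ n.+1.
have w0 m k : 0 <= w m k.
  by rewrite mulr_ge0 ?exprn_ge0 ?mulr_ge0// ltW// eball_volume_gt0.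
(* A sphere around x meets the cube only if its radius lies in this interval of length 2 r. *)
pose p m k := `|x - z m k| - r m k; pose q m k := `|x - z m k| + r m k.
pose phi m t := (\sum_(k <oo) (w m k * \1_(`[p m k, q m k]) t)%:E)%E.
have phi_ge m t d : 2 * (N%:R * m.+1%:R^-1) <= d ->
    (hausdorff_delta n.+1 d (S `&` [set y | `|x - y| = t]%R) <= phi m t)%E.
  move=> md; pose F k := if t \in `[p m k, q m k] then cube (z m k) (r m k) else set0.
  apply: (@le_trans _ _ (\sum_(k <oo) hausdorff_weight n.+1 (F k))%E).
    apply: ereal_inf_lbound; exists F => //; split => [k|y [Sy xy]].
      rewrite /F; case: ifP => _.
        apply: le_trans (diam_cube _ (r0 m k)) _.
        rewrite lee_fin; apply: le_trans md; rewrite ler_wpM2l// ler_wpM2l//.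
        by have [/(_ k)/andP[_ rm] _ _] := zrP m.
      by rewrite diam_set0 lee_fin; apply: le_trans md; rewrite !mulr_ge0.
    have [_ /(_ y Sy)[k _ yk] _] := zrP m; exists k => //.
    rewrite /F ifT ?mem_setE//; move: yk; rewrite (cubeE _ (r0 m k)) => zy.
    rewrite /= in_itv/= /p /q -xy.
    have {}zy : `|z m k - y| <= r m k := zy.
    have := ler_distD (z m k) x y; have := ler_distD y x (z m k).
    rewrite [`|y - _|]distrC; lra.
  apply: lee_nneseries => [k _ _|k _]; first exact: hausdorff_weight_ge0.
  rewrite indicE mem_setE /F; case: ifPn => _; rewrite ?mulr1 ?mulr0.
    exact: hausdorff_weight_cube.
  by rewrite hausdorff_weight_set0.
have phi0 m t : (0 <= phi m t)%E.
  by apply: nneseries_ge0 => k _ _; rewrite lee_fin mulr_ge0.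
pose J := [set` `]a, b[].
have mJ : measurable J by exact: measurable_itv.
have muJ : mu J = (b - a)%:E.
  by rewrite /J lebesgue_measure_itv/= lte_fin ab -EFinB.
have phi_int m : (\int[mu]_(t in J) phi m t <= (slice_const * v / 2)%:E)%E.
  apply: le_trans (integral_interval_sum_le _ _ mJ (w0 m)) _.
  apply: (@le_trans _ _ (\sum_(k <oo)
      ((slice_const / 2)%:E * ((2 * r m k) ^+ N)%:E))%E).
    apply: lee_nneseries => [k _ _|k _].
      by rewrite lee_fin mulr_ge0// le_max lexx.
    rewrite -EFinM lee_fin /w /p /q /slice_const.
    rewrite (_ : _ - (_ - _) = 2 * r m k); last by ring.
    rewrite max_r ?mulr_ge0// !exprMn.
    rewrite (_ : _ / 2 * _ = eball_volume R n.+1 * (N%:R ^+ n.+1) *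
       (2 * r m k ^+ N * 2 ^+ n.+1)); last by rewrite /N [2 ^+ n.+2]exprS; field.
    rewrite (_ : _ * (2 * _) = eball_volume R n.+1 * (N%:R ^+ n.+1) *
       (2 * r m k ^+ N)); last by rewrite /N [_ ^+ n.+2]exprS; ring.
    rewrite ler_wpM2l// ?mulr_ge0 ?exprn_ge0 ?(ltW (eball_volume_gt0 _ _))//.
    have h2 : 1 <= 2 ^+ n.+1 :> R by rewrite exprn_ege1// ler1n.
    by rewrite ler_peMr // mulr_ge0 ?exprn_ge0.
  rewrite nneseriesZl; last by move=> k _; rewrite lee_fin exprn_ge0// mulr_ge0.
  have -> : slice_const * v / 2 = slice_const / 2 * v by rewrite mulrAC.
  rewrite [leRHS]EFinM lee_wpmul2l//.
    by rewrite lee_fin divr_ge0// ltW// slice_const_gt0.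
  by have [_ _ /ltW] := zrP m.
have : (\int[mu]_(t in J) cst ((slice_const * v / (b - a))%:E) t <=
        (slice_const * v / 2)%:E)%E.
  (* The constant lies below the measure of every slice, hence below the lower limit of the [phi m].
     Only these measurable functions are integrated, never the measure of the slice itself. *)
  apply: (@le_trans _ _ (\int[mu]_(t in J) limn_einf (phi ^~ t))%E).
    apply: ge0_le_integral => //.
    - move=> t _; rewrite lee_fin divr_ge0 ?subr_ge0 ?(ltW ab)//.
      by rewrite mulr_ge0// ltW// slice_const_gt0.
    - rewrite (_ : (fun t => _) = fun t => (- limn_esup (fun m => - phi m t))%E).
        apply: measurableT_comp => //; apply: measurable_fun_limn_esup => m.
        by apply: measurableT_comp => //; exact: measurable_interval_sum.
      by apply/funext => t; rewrite -[RHS]limn_einfN; congr limn_einf;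
        apply/funext => m /=; rewrite oppeK.
    move=> t; rewrite /J/= in_itv/= => /none' /ltW /le_trans; apply.
    apply: hausdorff_le_delta => d d0.
    have [m0] : exists k, 0 + k.+1%:R^-1 < d / (2 * N%:R).
      by apply: ltr_add_invr; rewrite divr_gt0// mulr_gt0// ltr0n.
    rewrite add0r => m0d.
    apply: (limn_einf_ge (m0 := m0)) => m m0m; apply: phi_ge.
    rewrite mulrA mulrC -ler_pdivlMr ?mulr_gt0 ?ltr0n//.
    apply/ltW/(le_lt_trans _ m0d).
    by rewrite lef_pV2 ?posrE// ler_nat.
  apply: le_trans (@fatou _ _ _ mu J mJ phi _ _) _.
  - by move=> m; exact: measurable_interval_sum.
  - by move=> m t _.
  exact: limn_einf_le.
rewrite integral_cst//.
rewrite [X in (_ * X)%E](_ : _ = (b - a)%:E); last by rewrite -muJ.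
rewrite -EFinM lee_fin divfK ?subr_eq0 ?gt_eqF//.
rewrite ler_pdivlMr// ger_pMr ?(mulr_gt0 slice_const_gt0 v0)//.
by rewrite (ler_nat _ 2 1).
Qed.

End slicing.

(** * Perimeter and Hausdorff measure *)

(** The same function, packaged as a measure on the Caratheodory sets, so that integration theory
    applies to the integrals in [perimeter]. *)
Definition caratheodory_measure (R : realType) (T : pointedType)
    (mu : {outer_measure set T -> \bar R}) :
  {measure set (caratheodory_type mu) -> \bar R} := mu.

Section lebesgue_integration.
Context (R : realType) (n : nat).
Notation T := (caratheodory_type (@leb R n)).
Notation mu := (caratheodory_measure (@leb R n)).

Lemma continuous_measurable_leb (f : 'rV[R]_n -> R) :
  continuous f -> measurable_fun setT (f : T -> R).
Proof.
move=> /continuousP cf.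
apply: (measurability (@RGenOInfty.G R)).
  exact: RGenOInfty.measurableE.
move=> _ [_ [x ->] <-]; rewrite setTI; apply: open_measurable_leb.
by apply: cf; exact: interval_open.
Qed.

Lemma integrable_bounded_support (f : T -> R) (K : set T) (M : R) :
  measurable_fun setT f -> measurable K -> (leb K < +oo)%E ->
  (forall x, `|f x| <= M) -> (forall x, ~ K x -> f x = 0) ->
  mu.-integrable setT (EFin \o f).
Proof.
move=> mf mK Koo fM f0.
have fK : EFin \o f = (EFin \o f) \_ K.
  apply/funext => x; rewrite patchE; case: ifPn => //= xK.
  by rewrite f0// => Kx; case/negP: xK; exact/mem_set.
rewrite fK -(integrable_mkcond _ mK); apply: measurable_bounded_integrable => //.
  exact: measurable_funTS.
exists M; split; first exact: num_real.
by move=> x Mx y _; apply: le_trans (fM y) (ltW Mx).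
Qed.

Lemma measurable_translate (v : 'rV[R]_n) :
  measurable_fun setT ((fun x => x + v) : T -> T).
Proof.
move=> _ A mA; rewrite setTI; apply: le_caratheodory_measurable => X.
set P := [set x | A (x + v)] : set 'rV[R]_n.
have -> : (fun x => x + v : T) @^-1` A = P by [].
change (leb (X `&` P) + leb (X `&` ~` P) <= leb X)%E.
have mAX : leb [set x | X (x - v)] = (leb ([set x | X (x - v)%R] `&` A) +
  leb ([set x | X (x - v)%R] `&` ~` A))%E := mA [set x | X (x - v)].
rewrite -(leb_translate (- v) X) mAX -(leb_translate (- v) (X `&` P)).
rewrite -(leb_translate (- v) (X `&` ~` P)).
by apply: leeD; apply: leb_le => x; rewrite /P /setI /setC/= subrK.
Qed.

Lemma Rintegral_translate (v : 'rV[R]_n) (g : T -> R) :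
  measurable_fun setT g -> mu.-integrable setT (EFin \o (fun x => g (x + v))) ->
  \int[mu]_x g (x + v) = \int[mu]_x g x.
Proof.
move=> mg ig; rewrite /Rintegral; congr fine.
have mshift := measurable_translate v.
have E := @integral_pushforward _ _ _ _ _ _ mshift mu setT (EFin \o g)
  ((measurable_EFinP _ _).2 mg) ig measurableT.
apply: (etrans (esym E)).
apply: eq_measure_integral => A mA _; exact: (leb_translate v A).
Qed.

End lebesgue_integration.

Section directional_derivatives.
Context (R : realType) (n : nat) (phi : 'rV[R]_n -> 'rV[R]_n) (i : 'I_n).
Hypothesis phi_diff : forall x, differentiable phi x.
Let e : 'rV[R]_n := delta_mx 0 i.

Lemma cvg_coord_quotient (y : 'rV[R]_n) :
  (fun h : R => h^-1 * (phi (h *: e + y) 0 i - phi y 0 i)) @ 0^' -->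
    jacobian phi y i i.
Proof.
have dy : derivable phi y e := diff_derivable (phi_diff y).
have cv : (fun h : R => h^-1 *: ((phi \o shift y) (h *: e) - phi y)) @ 0^' -->
  'D_e phi y := dy.
rewrite (deriveEjacobian _ (phi_diff y)) -rowE in cv.
have := cvg_comp _ _ cv (@coord_continuous R 1 n 0 i (row i (jacobian phi y))).
rewrite mxE; apply: cvg_trans; apply: near_eq_cvg.
by near=> h; rewrite /= !mxE.
Unshelve. all: by end_near. Qed.

Lemma is_derive_coord (x : 'rV[R]_n) (s : R) :
  is_derive s 1 (fun s => phi (x + s *: e) 0 i) (jacobian phi (x + s *: e) i i).
Proof.
have cv : (fun h : R => h^-1 *: (((fun s => phi (x + s *: e) 0 i) \o shift s) (h *: 1)
    - phi (x + s *: e) 0 i)) @ 0^' --> jacobian phi (x + s *: e) i i.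
  apply: cvg_trans (cvg_coord_quotient (y := x + s *: e)).
  apply: near_eq_cvg; near=> h; congr (_ * (phi _ 0 i - _)).
  by rewrite /= [h *: 1]mulr1 scalerDl addrCA.
apply: DeriveDef; first by apply/cvg_ex; exists (jacobian phi (x + s *: e) i i).
exact: cvg_lim cv.
Unshelve. all: by end_near. Qed.

Lemma coord_quotient_le (L : R) (x : 'rV[R]_n) (t : R) :
  (forall y, `|jacobian phi y i i| <= L) -> 0 < t ->
  `|phi (x + t *: e) 0 i - phi x 0 i| <= L * t.
Proof.
move=> DL t0.
have [||c _] := @MVT R (fun s => phi (x + s *: e) 0 i)
   (fun s => jacobian phi (x + s *: e) i i) 0 t t0.
- by move=> s _; exact: is_derive_coord.
- apply: continuous_subspaceT => s; apply: differentiable_continuous.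
  by apply/derivable1_diffP; have [] := is_derive_coord x s.
rewrite scale0r addr0 subr0 => ->.
by rewrite normrM [`|t|]gtr0_norm// ler_wpM2r// ltW.
Qed.

Lemma continuous_coord : continuous (fun x => phi x 0 i).
Proof.
move=> x; apply: (@continuous_comp _ _ _ phi (fun z => z 0 i)).
  exact/differentiable_continuous.
exact: coord_continuous.
Qed.

Lemma continuous_jacobian_diag : continuous (fun x => jacobian phi x) ->
  continuous (fun x => jacobian phi x i i).
Proof.
move=> cJ x; apply: (@continuous_comp _ _ _ (jacobian phi) (fun J : 'M[R]_n => J i i)).
  exact: cJ.
exact: coord_continuous.
Qed.

Lemma jacobian_out (K : set 'rV[R]_n) : closed K ->
  (forall x, ~ K x -> phi x = 0) -> forall x, ~ K x -> jacobian phi x i i = 0.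
Proof.
move=> cK phi0 x Kx.
apply: (cvg_unique (@Rhausdorff R) (cvg_coord_quotient (y := x))).
apply: (@cvg_trans _ (cst 0 @ (0:R)^')); last exact: cvg_cst.
apply: near_eq_cvg; near=> h => /=.
rewrite [phi x]phi0// [phi _]phi0 ?mxE ?subrr ?mulr0//.
near: h; apply: nbhs_dnbhs.
have cvx : (h *: e + x) @[h --> (0 : R)] --> x.
  rewrite -[X in _ --> X]add0r -(scale0r e); apply: cvgD; last exact: cvg_cst.
  by apply: cvgZr_tmp; exact: cvg_id.
apply: (cvx (~` K)); apply: open_nbhs_nbhs; split => //.
exact: closed_openC.
Unshelve. all: by end_near. Qed.

End directional_derivatives.

Section finite_control.
Context (R : realType) (n : nat).

(** A Lebesgue number for the covering of K by E, the complement of its closure and the sets [B k];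
    compactness also leaves only finitely many k. *)
Lemma compact_ball_control (K E : set 'rV[R]_n) (B : nat -> set 'rV[R]_n) :
  compact K -> open E -> (forall k, open (B k)) ->
  K `&` tboundary E `<=` \bigcup_k B k ->
  exists (j : nat) (t0 : R), 0 < t0 /\ forall y, K y ->
    [\/ ball y t0 `<=` E, ball y t0 `<=` ~` E |
        exists2 k, (k < j)%N & ball y t0 `<=` B k].
Proof.
move=> /compact_near_coveringP cK oE oB KB.
(* A single parameter j, sent to infinity, both shrinks the radius and bounds the index k. *)
pose P (j : nat) y := [\/ ball y j.+1%:R^-1 `<=` E, ball y j.+1%:R^-1 `<=` ~` E |
        exists2 k, (k < j)%N & ball y j.+1%:R^-1 `<=` B k].
have near_open (U : set 'rV[R]_n) (x : 'rV[R]_n) : open U -> U x ->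
    exists2 d, 0 < d & forall (j : nat) x', ball x d x' -> j.+1%:R^-1 < d ->
      ball x' (j.+1%:R^-1 : R) `<=` U.
  move=> oU Ux; have /nbhs_ballP[d /= d0 dU] := open_nbhs_nbhs (conj oU Ux).
  exists (d / 2); first exact: divr_gt0.
  move=> j x' xx' jd y x'y; move: xx' x'y; rewrite !ball_rowE /= => xx' x'y.
  apply: dU; rewrite ball_rowE /=; apply: le_lt_trans (ler_distD x' _ _) _.
  by rewrite [d]splitr ltrD// (lt_trans x'y).
have nearP : \forall j \near \oo, K `<=` P j.
  apply: cK => x Kx.
  have [Ex|Ex] := pselect (E x).
    have [d d0 dU] := near_open _ _ oE Ex.
    exists (ball x d, [set j | j.+1%:R^-1 < d]).
      by split; [exact: nbhsx_ballx|exact: near_infty_natSinv_lt (PosNum d0)].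
    by move=> [x' j] [/= xx' jd]; apply: Or31; exact: dU.
  have [cEx|cEx] := pselect (closure E x); last first.
    have [d d0 dU] := near_open _ _ (closed_openC (@closed_closure _ E)) cEx.
    exists (ball x d, [set j | j.+1%:R^-1 < d]).
      by split; [exact: nbhsx_ballx|exact: near_infty_natSinv_lt (PosNum d0)].
    move=> [x' j] [/= xx' jd]; apply: Or32.
    by apply: subset_trans (dU _ _ xx' jd) _; apply: subsetC; exact: subset_closure.
  have [|k _ Bx] := KB x.
    by split => //; split => // /interior_subset.
  have [d d0 dU] := near_open _ _ (oB k) Bx.
  exists (ball x d, [set j | j.+1%:R^-1 < d] `&` [set j | (k < j)%N]).
    split; first exact: nbhsx_ballx.
    by apply: filterI; [exact: near_infty_natSinv_lt (PosNum d0)|exact: nbhs_infty_gt].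
  by move=> [x' j] [/= xx' [jd kj]]; apply: Or33; exists k => //; exact: dU.
have [j KP] := filter_ex nearP.
exists j, (j.+1%:R^-1); split; first by rewrite invr_gt0.
by move=> y /KP.
Qed.

End finite_control.

Section faces.
Context (R : realType) (n : nat).
Let N := n.+1.
Implicit Types (x y : 'rV[R]_N) (r t c : R) (i : 'I_N).

(** The slab swept by a face orthogonal to direction i under a shift by t. Its volume divided by t
    is the area of the face, and surface measure enters the proof only in this way. *)
Definition face x r i c t : set 'rV[R]_N :=
  box (Some (row_upd (x - const_mx r) i c, row_upd (x + const_mx r) i (c + t))).

Lemma leb_face x r i c t : 0 <= r -> 0 <= t ->
  (leb (face x r i c t) <= (t * (2 * r) ^+ n)%:E)%E.
Proof.
move=> r0 t0; apply: le_trans (leb_box_le _ _) _; rewrite lee_fin /=.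
rewrite (bigD1 i)//= !row_updE eqxx addrAC subrr add0r max_r//.
rewrite ler_wpM2l// (eq_bigr (fun=> 2 * r)) => [|j /negbTE ji].
  by rewrite prodr_const cardC1 card_ord.
by rewrite !row_updE ji !mxE max_r; [ring|lra].
Qed.

Lemma ball_rowP x r y : 0 < r -> ball x r y <-> forall i, `|x 0 i - y 0 i| < r.
Proof.
move=> r0; rewrite ball_rowE/=; split.
  by move=> /(row_norm_ltP _ r0) xy i; have := xy i; rewrite !mxE.
by move=> xy; apply/row_norm_ltP => // i; rewrite !mxE.
Qed.

Lemma ball_translate_face x r i t y : 0 < r -> 0 < t ->
  (ball x r y <> ball x r (y - t *: delta_mx 0 i)) ->
  face x r i (x 0 i - r) t y \/ face x r i (x 0 i + r) t y.
Proof.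
move=> r0 t0 jump.
have yE j : (y - t *: delta_mx 0 i) 0 j = y 0 j - (if j == i then t else 0).
  by rewrite !mxE eqxx/=; case: eqVneq; rewrite ?mulr1 ?mulr0.
have [yx|yx] := pselect (ball x r y).
  left; have /existsNP[j] : ~ forall j, `|x 0 j - (y - t *: delta_mx 0 i) 0 j| < r.
    move=> h; apply: jump; apply/propext; split => // _.
    by apply/ball_rowP.
  have /(ball_rowP _ _ r0) {}yx := yx.
  rewrite yE; case: eqVneq => [->|ji]; last by rewrite subr0 yx.
  move=> /negP; rewrite -leNgt => yi k; have := yx k.
  rewrite /= !row_updE; case: eqVneq => [->|ki].
    by move: yi; rewrite ltr_norml ler_normr; lra.
  by rewrite !mxE ltr_norml; lra.
right; have ytx : ball x r (y - t *: delta_mx 0 i).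
  by apply: contrapT => h; apply: jump; apply/propext; split.
have /existsNP[j] : ~ forall j, `|x 0 j - y 0 j| < r.
  by move=> h; apply: yx; apply/ball_rowP.
have /(ball_rowP _ _ r0) {}ytx := ytx.
have := ytx j; rewrite yE; case: eqVneq => [->|ji]; last by rewrite subr0.
move=> yti /negP; rewrite -leNgt => yi k; have := ytx k.
rewrite yE /= !row_updE; case: eqVneq => [->|ki].
  by move: yi yti; rewrite !ltr_norml ler_normr; lra.
by rewrite !mxE subr0 ltr_norml; lra.
Qed.

End faces.

Section directional_bound.
Context (R : realType) (n : nat).
Let N := n.+1.
Notation T := (caratheodory_type (@leb R N)).
Notation mu := (caratheodory_measure (@leb R N)).

Lemma leb_cube_fin (x : 'rV[R]_N) (r : R) : (leb (cube x r) < +oo)%E.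
Proof. by apply: le_lt_trans (leb_box_le _ _) _; rewrite ltry. Qed.

Lemma compact_sub_cube (K : set 'rV[R]_N) : compact K ->
  exists2 M : R, 0 < M & forall x, K x -> `|x| <= M.
Proof.
move=> /compact_bounded[M [_ KM]]; exists (`|M| + 1); first by rewrite ltr_wpDl.
by move=> x Kx; apply: KM => //; rewrite ltr_pwDr// ler_norm.
Qed.

Lemma bounded_measurable_superset (M : R) : 0 <= M -> exists Q : set T,
  [/\ measurable Q, (leb Q < +oo)%E & forall x : 'rV[R]_N, ~ Q x -> M < `|x|].
Proof.
move=> M0; exists (cube (0 : 'rV[R]_N) M); split.
- exact: measurable_box.
- exact: leb_cube_fin.
- by move=> x; rewrite cubeE//= sub0r normrN => /negP; rewrite -ltNge.
Qed.

Variables (f D : 'rV[R]_N -> R) (K : set 'rV[R]_N) (i : 'I_N) (L : R).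
Let e : 'rV[R]_N := delta_mx 0 i.
Hypothesis f_cont : continuous f.
Hypothesis D_cont : continuous D.
Hypothesis f_le1 : forall x, `|f x| <= 1.
Hypothesis K_compact : compact K.
Hypothesis f_out : forall x, ~ K x -> f x = 0.
Hypothesis f_quot : forall y,
  (fun h : R => h^-1 * (f (h *: e + y) - f y)) @ 0^' --> D y.
Hypothesis f_lip : forall y t, 0 < t -> `|f (y + t *: e) - f y| <= L * t.

Let L_ge0 : 0 <= L.
Proof. by have := f_lip 0 ltr01; rewrite mulr1; exact: le_trans. Qed.

Let norm_e : `|e| <= 1.
Proof.
apply/row_norm_leP => // j; rewrite mxE eqxx/=.
by case: (_ == _); rewrite ?normr1 ?normr0.
Qed.

Let mulf (g h : T -> R) : measurable_fun setT g -> measurable_fun setT h ->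
  measurable_fun setT (fun x => g x * h x).
Proof. exact: measurable_funM. Qed.

Let subf (g h : T -> R) : measurable_fun setT g -> measurable_fun setT h ->
  measurable_fun setT (fun x => g x - h x).
Proof. exact: measurable_funB. Qed.

(* Translation invariance moves the difference quotient from f to the indicator of V. *)
Lemma indic_shift_bound (V : set 'rV[R]_N) (Z : T -> R) (t : R) :
  0 < t -> measurable (V : set T) ->
  measurable_fun setT Z -> mu.-integrable setT (EFin \o Z) ->
  (forall y, K y -> `|\1_V (y - t *: e) - \1_V y : R| <= Z y) ->
  (forall y, 0 <= Z y) ->
  `|\int[mu]_x (\1_V x * (f (x + t *: e) - f x))| <= \int[mu]_x Z x.
Proof.
move=> t0 mV mZ iZ VZ Z0.
have [M M0 KM] := compact_sub_cube K_compact.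
have [Q [mQ Qfin Qout]] := bounded_measurable_superset (ltW (addr_gt0 M0 t0)).
have nte : `|t *: e| <= t.
  by rewrite normrZ gtr0_norm// ger_pMr.
have f0 x : ~ Q x -> f x = 0.
  move=> /Qout Mx; apply: f_out => /KM; apply/negP; rewrite -ltNge.
  by apply: lt_trans Mx; rewrite ltrDl.
have f0t x : ~ Q x -> f (x + t *: e) = 0.
  move=> /Qout Mx; apply: f_out => /KM; apply/negP; rewrite -ltNge.
  have := ler_normB (x + t *: e) (t *: e); rewrite addrK; lra.
have mf : measurable_fun setT (f : T -> R) by exact: continuous_measurable_leb.
have mft : measurable_fun setT ((fun x => f (x + t *: e)) : T -> R).
  exact: (measurableT_comp mf (measurable_translate _)).
have mI : measurable_fun setT (\1_V : T -> R) by exact: measurable_indic.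
have mIt : measurable_fun setT ((fun x => \1_V (x - t *: e)) : T -> R).
  exact: (measurableT_comp mI (measurable_translate _)).
have I1 x : `|\1_V x : R| <= 1.
  by rewrite indicE; case: (_ \in _); rewrite ?normr1 ?normr0.
have integr (g h : T -> R) : measurable_fun setT g -> measurable_fun setT h ->
    (forall x, `|g x| <= 1) -> (forall x, `|h x| <= 1) ->
    (forall x, ~ Q x -> h x = 0) ->
    mu.-integrable setT (EFin \o (fun x => g x * h x)).
  move=> mg mh g1 h1 hQ.
  apply: (@integrable_bounded_support _ _ _ Q 1 _ mQ Qfin).
  - exact: measurable_funM.
  - by move=> x; rewrite normrM mulr_ile1.
  - by move=> x /hQ ->; rewrite mulr0.
have -> : \int[mu]_x (\1_V x * (f (x + t *: e) - f x)) =
    \int[mu]_x ((\1_V (x - t *: e) - \1_V x) * f x).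
  under eq_Rintegral do rewrite mulrBr.
  under [RHS]eq_Rintegral do rewrite mulrBl.
  rewrite RintegralB//; [|exact: integr|exact: integr].
  rewrite RintegralB//; [|exact: integr|exact: integr].
  congr (_ - _).
  rewrite -(@Rintegral_translate _ _ (t *: e) (fun x => \1_V (x - t *: e) * f x)).
  - by apply: eq_Rintegral => x _; rewrite addrK.
  - exact: mulf.
  rewrite (_ : (fun x => _) = (fun x => \1_V x * f (x + t *: e))).
    exact: integr.
  by apply/funext => x; rewrite addrK.
have iprod : mu.-integrable setT (EFin \o (fun x => (\1_V (x - t *: e) - \1_V x) * f x)).
  apply: (@integrable_bounded_support _ _ _ Q 2 _ mQ Qfin).
  - exact: (mulf (subf mIt mI) mf).
  - move=> x; rewrite normrM -[leRHS]mulr1 ler_pM//.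
    apply: le_trans (ler_normB _ _) _.
    by rewrite [leRHS](_ : _ = 1 + 1)// lerD.
  - by move=> x /f0 ->; rewrite mulr0.
apply: le_trans (le_normr_Rintegral _ iprod) _ => //.
apply: le_Rintegral => //.
  exact: (integrable_norm iprod).
move=> x _; rewrite normrM.
have [Kx|/f_out ->] := pselect (K x); last by rewrite normr0 mulr0.
by apply: le_trans (VZ x Kx); rewrite ler_piMr.
Qed.

(** The difference quotients are bounded by the Lipschitz constant [L] and vanish off a fixed cube,
    so dominated convergence along t = 1 / (m + 1) gives the derivative. *)
Lemma directional_bound (V : set 'rV[R]_N) (B : R) (t0 : R) :
  0 < t0 -> measurable (V : set T) ->
  (forall t, 0 < t -> t < t0 ->
    `|\int[mu]_x (\1_V x * (f (x + t *: e) - f x))| <= B * t) ->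
  `|\int[mu]_x (\1_V x * D x)| <= B.
Proof.
move=> t00 mV VB.
have [M M0 KM] := compact_sub_cube K_compact.
(* The extra 1 leaves room for the shifts, which have length at most 1. *)
have [Q [mQ Qfin Qout]] := bounded_measurable_superset (ltW (addr_gt0 M0 ltr01)).
have mI : measurable_fun setT (\1_V : T -> R) by exact: measurable_indic.
have mf : measurable_fun setT (f : T -> R) by exact: continuous_measurable_leb.
pose h m : R := m.+1%:R^-1.
have h0 m : 0 < h m by rewrite invr_gt0.
have h1 m : h m <= 1 by rewrite invf_le1// ler1n.
pose g m x : R := \1_V x * ((h m)^-1 * (f (x + h m *: e) - f x)).
have mg m : measurable_fun setT (g m : T -> R).
  apply: (mulf mI (mulf (measurable_cst _) (subf _ mf))).
  exact: (measurableT_comp mf (measurable_translate _)).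
have I1 x : `|\1_V x : R| <= 1.
  by rewrite indicE; case: (_ \in _); rewrite ?normr1 ?normr0.
have gL m x : `|g m x| <= L * \1_Q x.
  rewrite /g normrM; have [Qx|Qx] := pselect (Q x).
    rewrite [in leRHS]indicE mem_set// mulr1 -[leRHS]mul1r ler_pM//.
    rewrite normrM normfV [`|h m|]gtr0_norm// mulrC ler_pdivrMr//.
    exact: f_lip.
  rewrite [in leRHS]indicE memNset// mulr0; move: Qx => /Qout Mx; rewrite [f x]f_out; last first.
    by move=> /KM; apply/negP; rewrite -ltNge; apply: lt_trans Mx; rewrite ltrDl.
  rewrite [f _]f_out ?subrr ?mulr0 ?normr0 ?mulr0//.
  move=> /KM; apply/negP; rewrite -ltNge.
  have nhe : `|h m *: e| <= 1.
    by rewrite normrZ gtr0_norm// mulr_ile1// ltW.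
  have := ler_normB (x + h m *: e) (h m *: e); rewrite addrK; lra.
have gcvg x : g m x @[m --> \oo] --> \1_V x * D x.
  apply: cvgMl_tmp.
  have := (cvg_at_rightP _ _ _).1 (cvg_dnbhs_at_right (@f_quot x)) h
    (conj h0 cvg_harmonic).
  apply: cvg_trans; apply: near_eq_cvg; apply: nearW => m /=.
  by rewrite [h m *: e + x]addrC.
have mD : measurable_fun setT (D : T -> R) by exact: continuous_measurable_leb.
have iQ : mu.-integrable setT (EFin \o (fun x => L * \1_Q x)).
  apply: (@integrable_bounded_support _ _ _ Q L _ mQ Qfin).
  - by apply: (mulf (measurable_cst _)); exact: measurable_indic.
  - move=> x; rewrite normrM [`|L|]ger0_norm// ler_piMr// indicE.
    by case: (_ \in _); rewrite ?normr1 ?normr0.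
  - by move=> x Qx; rewrite indicE memNset// mulr0.
have ig m : mu.-integrable setT (EFin \o g m).
  apply: (@integrable_bounded_support _ _ _ Q L _ mQ Qfin) => //.
  - by move=> x; apply: le_trans (gL m x) _; rewrite ler_piMr// indicE.
  - move=> x Qx; apply/eqP; rewrite -normr_le0; apply: le_trans (gL m x) _.
    by rewrite indicE memNset// mulr0.
have gcvgE x : (g m x)%:E @[m --> \oo] --> (\1_V x * D x)%:E.
  by apply/fine_cvgP; split; [exact: nearW|exact: gcvg].
have [||||iD _ dct] := @dominated_convergence _ _ _ mu setT measurableT
  (fun m x => (g m x)%:E) (fun x => (\1_V x * D x)%:E) (fun x => (L * \1_Q x)%:E)
  _ _ _ iQ _.
- by move=> m; exact/measurable_EFinP.
- by apply/measurable_EFinP; exact: (mulf mI mD).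
- by apply: aeW => x _; exact: gcvgE.
- by apply: aeW => x m _; rewrite lee_fin.
have cvgR : (\int[mu]_x g m x)%R @[m --> \oo] --> (\int[mu]_x (\1_V x * D x))%R.
  apply: fine_cvg; rewrite /Rintegral fineK//.
  exact: (integrable_fin_num measurableT iD).
rewrite -(cvg_lim _ (cvg_norm cvgR))//; apply: limr_le.
  by apply/cvg_ex; eexists; exact: (cvg_norm cvgR).
near=> m.
have hm : h m < t0.
  by near: m; exact: (near_infty_natSinv_lt (PosNum t00)).
have := VB _ (h0 m) hm.
rewrite (_ : \int[mu]_x _ = h m * \int[mu]_x g m x).
  by rewrite normrM gtr0_norm// mulrC ler_pM2r.
rewrite -RintegralZl//; apply: eq_Rintegral => x _.
by rewrite /g mulrCA mulVKf// gt_eqF.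
Unshelve. all: by end_near. Qed.

End directional_bound.

Section perimeter_bound.
Context (R : realType) (n : nat).
Let N := n.+2.
Notation T := (caratheodory_type (@leb R N)).
Notation mu := (caratheodory_measure (@leb R N)).

(** A majorant for the change of an indicator under a shift by t in direction i, with integral at
    most t times the total area of the faces. *)
Definition faces_count (x : nat -> 'rV[R]_N) (r : nat -> R) (i : 'I_N) (t : R)
    (j : nat) (y : 'rV[R]_N) : R :=
  \sum_(k < j) (\1_(face (x k) (r k) i (x k 0 i - r k) t) y +
                \1_(face (x k) (r k) i (x k 0 i + r k) t) y).

Section faces_integral.
Variables (x : nat -> 'rV[R]_N) (r : nat -> R) (i : 'I_N) (t : R) (j : nat).
Hypothesis r_ge0 : forall k, 0 <= r k.
Hypothesis t_ge0 : 0 <= t.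
Notation Z := (faces_count x r i t j).

Lemma measurable_indic_face k c : measurable_fun setT (\1_(face (x k) (r k) i c t) : T -> R).
Proof. by apply: measurable_indic; exact: measurable_box. Qed.

Lemma measurable_faces_count : measurable_fun setT (Z : T -> R).
Proof.
apply: measurable_sum => k.
exact: (measurable_funD (measurable_indic_face _ _) (measurable_indic_face _ _)).
Qed.

Lemma faces_count_ge0 y : 0 <= Z y.
Proof. by apply: sumr_ge0 => k _; rewrite addr_ge0. Qed.

Lemma integral_faces_count :
  (\int[mu]_y (Z y)%:E <= (\sum_(k < j) 2 * (2 * r k) ^+ n.+1 * t)%:E)%E.
Proof.
under eq_integral do rewrite /faces_count -sumEFin.
rewrite (ge0_integral_sum mu measurableT); last 2 first.
- move=> k; apply/measurable_EFinP.
  exact: (measurable_funD (measurable_indic_face _ _) (measurable_indic_face _ _)).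
- by move=> k y _; rewrite lee_fin addr_ge0.
rewrite -sumEFin; apply: lee_sum => k _.
under eq_integral do rewrite EFinD.
rewrite (ge0_integralD mu measurableT); last 4 first.
- by move=> y _; rewrite lee_fin.
- by apply/measurable_EFinP; exact: measurable_indic_face.
- by move=> y _; rewrite lee_fin.
- by apply/measurable_EFinP; exact: measurable_indic_face.
have mF c : measurable (face (x k) (r k) i c t : set T) by exact: measurable_box.
rewrite !integral_indic// !setIT.
rewrite [leRHS](_ : _ = (t * (2 * r k) ^+ n.+1)%:E + (t * (2 * r k) ^+ n.+1)%:E)%E.
  by apply: leeD; exact: leb_face.
by rewrite -EFinD; congr EFin; ring.
Qed.

Lemma integrable_faces_count : mu.-integrable setT (EFin \o Z).
Proof.
apply/integrableP; split; first by apply/measurable_EFinP; exact: measurable_faces_count.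
have -> : (\int[mu]_y `|(EFin \o Z) y| = \int[mu]_y (Z y)%:E)%E.
  by apply: eq_integral => y _; rewrite /= ger0_norm// faces_count_ge0.
by apply: le_lt_trans integral_faces_count _; rewrite ltry.
Qed.

Lemma Rintegral_faces_count :
  \int[mu]_y Z y <= (\sum_(k < j) 2 * (2 * r k) ^+ n.+1) * t.
Proof.
rewrite mulr_suml -lee_fin /Rintegral fineK; first exact: integral_faces_count.
exact: (integrable_fin_num measurableT integrable_faces_count).
Qed.

End faces_integral.

(** The ball of radius t0 around y does not meet the boundary of E outside the removed balls. So
    membership in V changes between y and its shift only if membership in a removed ball does, and
    then y is in one of the slabs of that ball. *)
Lemma indic_jump (E : set 'rV[R]_N) (x : nat -> 'rV[R]_N) (r : nat -> R)
    (i : 'I_N) (j : nat) (t0 t : R) (y : 'rV[R]_N) :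
  (forall k, 0 < r k) -> 0 < t -> t < t0 ->
  [\/ ball y t0 `<=` E, ball y t0 `<=` ~` E |
      exists2 k, (k < j)%N & ball y t0 `<=` ball (x k) (r k)] ->
  forall V, V = E `\` \bigcup_(k in [set k | (k < j)%N]) ball (x k) (r k) ->
  `|\1_V (y - t *: delta_mx 0 i) - \1_V y : R| <= faces_count x r i t j y.
Proof.
move=> r0 tpos tt0 ctrl V eV; set y' := y - _.
have [VV|VV] := eqVneq (\1_V y' : R) (\1_V y).
  by rewrite VV subrr normr0 faces_count_ge0.
have yy : ball y t0 y by apply: ballxx; exact: lt_trans tt0.
have yy' : ball y t0 y'.
  rewrite ball_rowE /= /y' subKr; apply: le_lt_trans tt0.
  rewrite normrZ gtr0_norm// ger_pMr//; apply/row_norm_leP => // l.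
  by rewrite mxE eqxx/=; case: (l == i); rewrite ?normr1 ?normr0.
have [k kj jump] : exists2 k, (k < j)%N & ball (x k) (r k) y <> ball (x k) (r k) y'.
  apply: contrapT => nojump.
  have same k : (k < j)%N -> ball (x k) (r k) y = ball (x k) (r k) y'.
    by move=> kj; apply: contrapT => h; apply: nojump; exists k.
  move/eqP: VV; apply; rewrite eV !indicE; congr (nat_of_bool _)%:R.
  apply/idP/idP => /set_mem[Ey Wy]; apply/mem_set.
    case: ctrl => [sE|sE|[k kj sB]].
    - by split; [exact: sE|move=> [k kj]; rewrite same// => ?; apply: Wy; exists k].
    - by have := sE _ yy'.
    - by exfalso; apply: Wy; exists k => //; exact: sB.
  case: ctrl => [sE|sE|[k kj sB]].
  - by split; [exact: sE|move=> [k kj]; rewrite -same// => ?; apply: Wy; exists k].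
  - by have := sE _ yy.
  - by exfalso; apply: Wy; exists k => //; exact: sB.
apply: (@le_trans _ _ 1).
  rewrite !indicE; case: (y' \in V); case: (y \in V);
    by rewrite ?subrr ?subr0 ?sub0r ?normrN ?normr1 ?normr0.
rewrite /faces_count (bigD1 (Ordinal kj))//=.
apply: (@le_trans _ _ (\1_(face (x k) (r k) i (x k 0 i - r k) t) y +
                \1_(face (x k) (r k) i (x k 0 i + r k) t) y)); last first.
  by rewrite lerDl; apply: sumr_ge0 => l _; rewrite addr_ge0.
have [fy|fy] := ball_translate_face (r0 k) tpos jump.
  by rewrite [X in _ <= X + _]indicE mem_set// lerDl.
by rewrite [X in _ <= _ + X]indicE mem_set// lerDr.
Qed.

End perimeter_bound.

Section perimeter_le_hausdorff.
Context (R : realType) (n : nat).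
Let N := n.+2.
Notation T := (caratheodory_type (@leb R N)).
Notation mu := (caratheodory_measure (@leb R N)).

(** There are N directions, and in each of them a ball of radius r has two faces of area (2
    r)^(n+1), together 2^(n+2) r^(n+1). *)
Definition perimeter_const : R :=
  N%:R * (2 ^+ n.+2 * hausdorff_cover_const R n.+1).

Lemma perimeter_const_gt0 : 0 < perimeter_const.
Proof.
by rewrite mulr_gt0// mulr_gt0 ?exprn_gt0// hausdorff_cover_const_gt0.
Qed.

Lemma jacobian_bounded (phi : 'rV[R]_N -> 'rV[R]_N) (K : set 'rV[R]_N) :
  (forall x, differentiable phi x) -> continuous (fun x => jacobian phi x) ->
  compact K -> (forall x, ~ K x -> phi x = 0) ->
  exists2 L : R, 0 <= L & forall i y, `|jacobian phi y i i| <= L.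
Proof.
move=> dphi cphi cK phi0.
have closedK : closed K by apply: compact_closed => //; exact: norm_hausdorff.
have [L LP] : {L : 'I_N -> R & forall i, 0 <= L i /\ forall y, `|jacobian phi y i i| <= L i}.
  apply: (@choice _ _ (fun i L => 0 <= L /\ forall y, `|jacobian phi y i i| <= L)) => i.
  have cD := continuous_jacobian_diag (i := i) cphi.
  have /compact_bounded[M [_ DM]] :
      compact ((fun y => jacobian phi y i i : R^o) @` K).
    by apply: continuous_compact => //; exact: continuous_subspaceT.
  exists (`|M| + 1); split => [|y]; first by rewrite addr_ge0.
  have [Ky|Ky] := pselect (K y).
    by apply: (DM (`|M| + 1)); [rewrite ltr_pwDr// ler_norm|exists y].
  by rewrite (jacobian_out i dphi closedK phi0)// normr0 addr_ge0.
exists (\sum_i L i) => [|i y]; first by apply: sumr_ge0 => i _; have [] := LP i.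
apply: le_trans (proj2 (LP i) y) _; rewrite (bigD1 i)//= lerDl.
by apply: sumr_ge0 => k _; have [] := LP k.
Qed.

Section fixed_field.
Variables (phi : 'rV[R]_N -> 'rV[R]_N) (K E : set 'rV[R]_N) (L : R).
Hypothesis phi_diff : forall x, differentiable phi x.
Hypothesis phi_C1 : continuous (fun x => jacobian phi x).
Hypothesis phi_le1 : forall x, enorm (phi x) <= 1.
Hypothesis K_compact : compact K.
Hypothesis phi_out : forall x, ~ K x -> phi x = 0.
Hypothesis E_open : open E.
Hypothesis L_ge0 : 0 <= L.
Hypothesis jac_le : forall i y, `|jacobian phi y i i| <= L.

Let continuous_jac i : continuous (fun y => jacobian phi y i i).
Proof. exact: continuous_jacobian_diag. Qed.

Let jac_out i x : ~ K x -> jacobian phi x i i = 0.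
Proof.
apply: jacobian_out => //; apply: compact_closed => //; exact: norm_hausdorff.
Qed.

Let integrable_jac (V : set T) i : measurable V ->
  mu.-integrable setT (EFin \o (fun x => \1_V x * jacobian phi x i i)).
Proof.
move=> mV; have [M M0 KM] := compact_sub_cube K_compact.
have [Q [mQ Qfin Qout]] := bounded_measurable_superset n.+1 (ltW M0).
have mI : measurable_fun setT (\1_V : T -> R) by exact: measurable_indic.
have mD : measurable_fun setT ((fun y => jacobian phi y i i) : T -> R).
  exact: continuous_measurable_leb.
apply: (@integrable_bounded_support _ _ _ Q L _ mQ Qfin).
- exact: (measurable_funM mI mD).
- move=> x; rewrite normrM -[leRHS]mul1r ler_pM// indicE.
  by case: (x \in V); rewrite ?normr1 ?normr0.
- move=> x /Qout Mx; rewrite jac_out ?mulr0// => /KM; apply/negP.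
  by rewrite -ltNge.
Qed.

Let directional (x : nat -> 'rV[R]_N) (r : nat -> R) (j : nat) (t0 : R) (V : set 'rV[R]_N) i :
  (forall k, 0 < r k) -> 0 < t0 ->
  (forall y, K y -> [\/ ball y t0 `<=` E, ball y t0 `<=` ~` E |
      exists2 k, (k < j)%N & ball y t0 `<=` ball (x k) (r k)]) ->
  V = E `\` \bigcup_(k in [set k | (k < j)%N]) ball (x k) (r k) ->
  measurable (V : set T) ->
  `|\int[mu]_y (\1_V y * jacobian phi y i i)| <= \sum_(k < j) 2 * (2 * r k) ^+ n.+1.
Proof.
move=> r0 t00 ctrl eV mV.
have f1 y : `|phi y 0 i| <= 1.
  apply: le_trans (coord_le_norm _ _) _; apply: le_trans (norm_le_enorm _) _.
  exact: phi_le1.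
have f0 y : ~ K y -> phi y 0 i = 0 by move=> /phi_out ->; rewrite mxE.
have lip y t : 0 < t -> `|phi (y + t *: delta_mx 0 i) 0 i - phi y 0 i| <= L * t.
  by move=> tp; apply: coord_quotient_le.
have quot (y : 'rV[R]_N) :
    (fun h : R => h^-1 * (phi (h *: delta_mx 0 i + y) 0 i - phi y 0 i)) @ 0^' -->
      jacobian phi y i i by exact: cvg_coord_quotient.
apply: (directional_bound (i := i) (@continuous_coord R N phi i phi_diff)
  (@continuous_jac i) K_compact f0 quot lip t00 mV).
move=> t tp tt0; have r0' k : 0 <= r k by exact: ltW.
apply: le_trans (Rintegral_faces_count x i j r0' (ltW tp)).
apply: (indic_shift_bound (@continuous_coord R N phi i phi_diff) f1 K_compact f0 tp mV).
- exact: measurable_faces_count.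
- exact: integrable_faces_count (ltW tp).
- by move=> y Ky; apply: (indic_jump i r0 tp tt0 (ctrl y Ky) eV).
- by move=> y; exact: faces_count_ge0.
Qed.

(* The small balls covering the boundary of E are removed from E: near K the boundary
   of the remaining set V consists of pieces of faces of cubes. *)
Lemma integral_divergence_le (x : nat -> 'rV[R]_N) (r : nat -> R) (j : nat)
    (t0 d S : R) :
  (forall k, 0 < r k <= d) -> 0 < t0 ->
  (forall y, K y -> [\/ ball y t0 `<=` E, ball y t0 `<=` ~` E |
      exists2 k, (k < j)%N & ball y t0 `<=` ball (x k) (r k)]) ->
  (\sum_(k <oo) (r k ^+ n.+1)%:E <= S%:E)%E ->
  (\int[mu]_(y in E) (divergence phi y)%:E <=
   (N%:R * (2 ^+ n.+2 * S * (1 + L * d)))%:E)%E.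
Proof.
move=> rd t00 ctrl rS.
have r0 k : 0 < r k by case/andP: (rd k).
have d0 : 0 <= d by case/andP: (rd 0%N) => /ltW /le_trans; apply.
pose W := \bigcup_(k in [set k | (k < j)%N]) ball (x k) (r k).
(* On [V] the faces bound the integral. The discarded part [W'] has volume at most 2^(n+2) S d, and
   the derivatives there are at most L; this is the term L d. *)
pose V := E `\` W; pose W' := E `&` W.
have mE : measurable (E : set T) by exact: open_measurable_leb.
have mW : measurable (W : set T).
  by apply: bigcup_measurable => k _; apply: open_measurable_leb; exact: ball_open.
have mV : measurable (V : set T) by exact: measurableD.
have mW' : measurable (W' : set T) by exact: measurableI.
have W'S : (leb W' <= (2 ^+ n.+2 * S * d)%:E)%E.
  apply: (@le_trans _ _ (leb (\bigcup_k ball (x k) (r k)))).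
    by apply: leb_le => y [_ [k _ By]]; exists k.
  apply: le_trans (leb_sigma_subadditive _) _.
  apply: (@le_trans _ _ (\sum_(k <oo) ((2 ^+ n.+2 * d)%:E * (r k ^+ n.+1)%:E))%E).
    apply: lee_nneseries => [k _ _|k _]; first exact: leb_ge0.
    apply: le_trans (leb_ball_le _ (ltW (r0 k))) _.
    rewrite -EFinM lee_fin exprMn -[leRHS]mulrA ler_wpM2l ?exprn_ge0//.
    by rewrite [leLHS]exprS ler_wpM2r ?exprn_ge0 ?(ltW (r0 k))//; case/andP: (rd k).
  rewrite nneseriesZl; last by move=> k _; rewrite lee_fin exprn_ge0// ltW.
  have -> : 2 ^+ n.+2 * S * d = 2 ^+ n.+2 * d * S by rewrite mulrAC.
  by rewrite [leRHS]EFinM lee_wpmul2l// lee_fin mulr_ge0 ?exprn_ge0.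
have W'fin : leb W' \is a fin_num.
  by rewrite ge0_fin_numE ?leb_ge0// (le_lt_trans W'S)// ltry.
pose a (A : set 'rV[R]_N) i := \int[mu]_y (\1_A y * jacobian phi y i i).
have aE i : a E i = a V i + a W' i.
  rewrite /a -RintegralD//; [|exact: integrable_jac|exact: integrable_jac].
  apply: eq_Rintegral => y _; rewrite -mulrDl; congr (_ * _).
  rewrite !indicE /V /W' in_setD in_setI.
  by case: (y \in E); case: (y \in W); rewrite /= ?addr0 ?add0r.
have aV i : a V i <= 2 ^+ n.+2 * S.
  apply: le_trans (ler_norm _) _.
  apply: le_trans (directional i r0 t00 ctrl erefl mV) _.
  have -> : \sum_(k < j) 2 * (2 * r k) ^+ n.+1 = 2 ^+ n.+2 * \sum_(k < j) r k ^+ n.+1.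
    by rewrite mulr_sumr; apply: eq_bigr => k _; rewrite exprMn mulrA -exprS.
  rewrite ler_wpM2l ?exprn_ge0// -lee_fin -sumEFin; apply: le_trans rS.
  rewrite -(big_mkord xpredT (fun k => (r k ^+ n.+1)%:E)).
  by apply: nneseries_lim_ge => k _ _; rewrite lee_fin exprn_ge0// ltW.
have aW' i : a W' i <= L * (2 ^+ n.+2 * S * d).
  have i1 : mu.-integrable setT (EFin \o (\1_W' : T -> R)).
    apply: (@integrable_bounded_support _ _ _ W' 1) => //.
    - by rewrite -ge0_fin_numE ?leb_ge0.
    - by move=> y; rewrite indicE; case: (y \in W'); rewrite ?normr1 ?normr0.
    - by move=> y Wy; rewrite indicE memNset.
  apply: (@le_trans _ _ (\int[mu]_y (L * \1_W' y))).
    apply: le_Rintegral => //; first exact: integrable_jac.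
      exact: (integrableZl measurableT L i1).
    move=> y _; rewrite mulrC ler_wpM2r//.
    by apply: le_trans (ler_norm _) (jac_le _ _).
  rewrite RintegralZl// ler_wpM2l// /Rintegral integral_indic// setIT.
  by rewrite -lee_fin fineK.
rewrite integral_mkcond.
have -> : (\int[mu]_y ((fun y => (divergence phi y)%:E) \_ E) y =
   \int[mu]_y (\sum_(i < N) (\1_E y * jacobian phi y i i)%:E))%E.
  apply: eq_integral => y _; rewrite patchE sumEFin -mulr_sumr indicE.
  by case: ifPn => _; rewrite ?mul1r ?mul0r.
rewrite integral_sum//; last by move=> i; exact: integrable_jac.
apply: (@le_trans _ _ (\sum_(i < N) (2 ^+ n.+2 * S * (1 + L * d))%:E)%E); last first.
  by rewrite sumEFin sumr_const card_ord mulr_natl.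
apply: lee_sum => i _.
have -> : (\int[mu]_y (\1_E y * jacobian phi y i i)%:E)%E = (a E i)%:E.
  rewrite fineK//; apply: (@integrable_fin_num _ _ _ mu setT measurableT).
  exact: integrable_jac.
rewrite lee_fin aE mulrDr mulr1 lerD//.
by rewrite mulrCA.
Qed.

End fixed_field.

(** The bound L on the derivatives depends on the test field, but the radii of the cover are chosen
    after the field and the constant does not involve them; the term with L can therefore be made
    arbitrarily small. *)
Lemma perimeter_le_hausdorff (E U : set 'rV[R]_N) : open E ->
  (perimeter E U <= perimeter_const%:E * hausdorff n.+1 (tboundary E `&` U))%E.
Proof.
move=> oE; set H := hausdorff _ _.
have [Hoo|/eqP Hoo] := eqVneq H +oo%E.
  by rewrite Hoo gt0_muley ?leey// lte_fin perimeter_const_gt0.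
have Hfin : H \is a fin_num.
  by rewrite ge0_fin_numE ?hausdorff_ge0// ltey; exact/eqP.
apply: ge_ereal_sup => _ [phi [[dphi cphi [K [cK KU phi0]]] phi1] <-].
have [L L0 jacL] := jacobian_bounded dphi cphi cK phi0.
apply/lee_addgt0Pr => e e0.
pose y := fine H + e / (2 * perimeter_const).
have CP0 := perimeter_const_gt0.
have ye : 0 < e / (2 * perimeter_const) by rewrite divr_gt0// mulr_gt0.
have Hy : (H < y%:E)%E by rewrite -(fineK Hfin) lte_fin ltrDl.
have y0 : 0 < y by rewrite ltr_wpDl// fine_ge0// hausdorff_ge0.
pose A := perimeter_const * y * L.
have A0 : 0 <= A by rewrite mulr_ge0// mulr_ge0// ltW.
(* Half of the error e is kept for the term A d, the other half is spent in y; A + 1 avoids dividing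
   by zero. *)
pose d := e / (2 * (A + 1)).
have d0 : 0 < d by rewrite divr_gt0// mulr_gt0// ltr_wpDl.
have Ad : A * d <= e / 2.
  have A1 : 0 < A + 1 by rewrite ltr_wpDl.
  have -> : A * d = e / 2 * (A / (A + 1)) by rewrite /d; field; rewrite gt_eqF.
  by rewrite ler_piMr ?ler_pdivrMr ?mul1r ?lerDl// divr_ge0// ltW.
have [//|x [r [rd cov rsum]]] := hausdorff_ball_cover _ d0 Hy.
have KEB : K `&` tboundary E `<=` \bigcup_k ball (x k) (r k).
  by move=> z [Kz Ez]; apply: cov; split => //; exact: KU.
have [j [t0 [t00 ctrl]]] := compact_ball_control cK oE (fun k => ball_open _ _) KEB.
apply: le_trans (integral_divergence_le dphi cphi phi1 cK phi0 oE L0 jacL rd t00 ctrl rsum) _.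
rewrite -(fineK Hfin) -EFinM -EFinD lee_fin.
have -> : N%:R * (2 ^+ n.+2 * (hausdorff_cover_const R n.+1 * y) * (1 + L * d)) =
   perimeter_const * y + A * d by rewrite /A /perimeter_const; ring.
have -> : perimeter_const * y = perimeter_const * fine H + e / 2.
  by rewrite /y mulrDr; congr (_ + _); field; rewrite gt_eqF.
by rewrite -addrA lerD2l [leRHS]splitr lerD2l.
Qed.

End perimeter_le_hausdorff.

(** * Vitali covers *)

Section vitali.
Context (R : realType) (V : normedModType R).
Variables (P : set V) (r : V -> R) (M : R).
Hypothesis r_gt0 : forall x, P x -> 0 < r x.
Hypothesis r_le : forall x, P x -> r x <= M.

Let meets x y := ball x (r x) `&` ball y (r y) !=set0.

(* Maximality among disjoint families D such that a ball meeting the family meets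
   one of its members of at least half its radius. *)
Lemma vitali_selection : exists D : set V,
  [/\ D `<=` P,
      forall x y, D x -> D y -> x != y -> ball x (r x) `&` ball y (r y) = set0 &
      forall x, P x -> exists2 y, D y & ball y (3 * r y) x].
Proof.
pose good (D : set V) := [/\ D `<=` P,
  forall x y, D x -> D y -> x != y -> ball x (r x) `&` ball y (r y) = set0 &
  forall x, P x -> (exists2 y, D y & meets x y) ->
    exists y, [/\ D y, meets x y & r x <= 2 * r y]].
have [F Fgood Ftot|D [[DP Dd Dhalf] Dmax]] := @Zorn_bigcup V good.
  split.
  - by move=> x [X /Fgood[XP _ _] Xx]; exact: XP.
  - move=> x y [X FX Xx] [Y FY Yy] xy.
    have [XY|YX] := Ftot X Y FX FY.
      by have [_ Yd _] := Fgood Y FY; apply: Yd => //; exact: XY.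
    by have [_ Xd _] := Fgood X FX; apply: Xd => //; exact: YX.
  - move=> x Px [y [X FX Xy] xy]; have [_ _ Xh] := Fgood X FX.
    by have [|z [Xz xz rz]] := Xh x Px; [exists y|exists z; split => //; exists X].
exists D; split => // x Px.
have [[y [Dy [z [xz yz]] rxy]]|nomeet] := pselect (exists y, [/\ D y, meets x y & r x <= 2 * r y]).
  exists y => //; rewrite -ball_normE /= distrC.
  move: xz yz; rewrite -!ball_normE /= => xz yz.
  apply: le_lt_trans (ler_distD z _ _) _; rewrite [`|z - _|]distrC.
  by apply: lt_le_trans (ltrD xz yz) _; lra.
exfalso.
pose Q := [set x | P x /\ forall y, D y -> ~ meets x y].
have Qx : Q x.
  split => // y Dy xy; apply: nomeet.
  by apply: Dhalf => //; exists y.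
(* A ball missed by the family with more than half the supremal radius among the missed ones can be
   added, against maximality. *)
pose s := sup (r @` Q).
have rs z : Q z -> r z <= s.
  move=> Qz; apply: ub_le_sup; last by exists z.
  by exists M => _ [w [Pw _] <-]; exact: r_le.
have s0 : 0 < s by apply: lt_le_trans (rs _ Qx); exact: r_gt0.
have [||_ [x0 Qx0 <-] rx0] := @sup_gt _ (r @` Q) (s / 2).
- by exists (r x), x.
- by rewrite ltr_pdivrMr// ltr_pMr// ltr1n.
have [Px0 x0D] := Qx0.
apply: (Dmax (D `|` [set x0])).
  split; first by left.
  move=> /(_ x0 (or_intror erefl)) Dx0; apply: (x0D x0 Dx0).
  by exists x0; split; apply: ballxx; exact: r_gt0.
split.
- by move=> z [/DP//|->].
- have disj z : D z -> ball z (r z) `&` ball x0 (r x0) = set0.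
    move=> Dz; apply: contrapT => /eqP/set0P zx0; apply: (x0D z Dz).
    by rewrite /meets setIC.
  move=> a b [Da|->] [Db|->].
  + exact: Dd.
  + by move=> _; exact: disj.
  + by move=> _; rewrite setIC; exact: disj.
  + by rewrite eqxx.
- move=> z Pz [y Dy zy].
  have [[w Dw zw]|zD] := pselect (exists2 w, D w & meets z w).
    have [|u [Du zu rzu]] := Dhalf z Pz; first by exists w.
    by exists u; split => //; left.
  case: Dy => [Dy|Dy]; first by exfalso; apply: zD; exists y.
  exists x0; split; [by right|by rewrite -Dy|].
  have Qz : Q z by split => // w Dw zw; apply: zD; exists w.
  apply: le_trans (rs _ Qz) _.
  by rewrite mulrC -ler_pdivrMr// ltW.
Qed.

End vitali.

Section summable_families.
Context (R : realType) (V : choiceType).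
Variables (D : set V) (a : V -> R) (B : R).
Hypothesis a_gt0 : forall x, D x -> 0 < a x.
Hypothesis sum_le : forall u : seq V, uniq u -> (forall x, x \in u -> D x) ->
  \sum_(x <- u) a x <= B.

(** There are at most B / e such terms. Besides countability, this shows that only finitely many
    selected balls exceed a given size. *)
Lemma finite_large_terms (e : R) : 0 < e -> finite_set [set x | D x /\ e <= a x].
Proof.
move=> e0; apply: contrapT => inf.
have B0 : 0 <= B by have := sum_le (u := [::]) isT; rewrite big_nil; apply.
have [F FD Fn] := infinite_set_fset (Num.trunc (B / e)).+1 inf.
have := sum_le (finmap.fset_uniq F) (fun x xF => (FD x xF).1).
apply/negP; rewrite -ltNge.
apply: (@lt_le_trans _ _ (\sum_(x <- finmap.enum_fset F) e)).
  rewrite big_const_seq count_predT iter_addr addr0 -mulr_natr.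
  rewrite mulrC -ltr_pdivrMr//.
  by apply: lt_le_trans (truncnS_gt _) _; rewrite ler_nat.
by rewrite big_seq [leRHS]big_seq; apply: ler_sum => x /FD[].
Qed.

(* The enumeration is allowed to skip indices, so that D may be finite. *)
Lemma summable_enumeration : exists e : nat -> option V,
  [/\ forall k x, e k = Some x -> D x,
      forall x, D x -> exists k, e k = Some x &
      (\sum_(k <oo) (oapp a 0 (e k))%:E <= B%:E)%E].
Proof.
have cD : countable D.
  rewrite (_ : D = \bigcup_m [set x | D x /\ m.+1%:R^-1 <= a x]).
    apply: bigcup_countable => [|m _]; first exact: countableP.
    by apply: finite_set_countable; apply: finite_large_terms; rewrite invr_gt0.
  apply/seteqP; split => [x Dx|x [m _ []]//].
  have [m] : exists k, 0 + k.+1%:R^-1 < a x by apply: ltr_add_invr; exact: a_gt0.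
  by rewrite add0r => ma; exists m => //; split => //; exact: ltW.
have /countable_injP[f finj] := cD.
pose e k := if pselect (exists x, D x /\ f x = k) is left p
            then Some (sval (cid p)) else None.
have eD k x : e k = Some x -> D x /\ f x = k.
  by rewrite /e; case: pselect => // p [<-]; exact: (svalP (cid p)).
exists e; split.
- by move=> k x /eD[].
- move=> x Dx; exists (f x); rewrite /e; case: pselect => [p|[]]; last by exists x.
  congr Some; have [Dp fp] := svalP (cid p).
  by apply: finj => //; exact: mem_set.
- apply: lime_le.
    apply: is_cvg_nneseries => k _ _; rewrite lee_fin.
    by case ek: (e k) => [x|]//=; apply/ltW/a_gt0; have [] := eD _ _ ek.
  apply: nearW => m; rewrite sumEFin lee_fin -big_pmap; apply: sum_le.
    apply: (pmap_uniq (g := f)); last exact: iota_uniq.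
    by move=> k /=; case ek: (e k) => [x|]//=; have [] := eD _ _ ek.
  by move=> x; rewrite mem_pmap => /mapP[k _ /esym /eD[]].
Qed.

End summable_families.

(** * Density of the boundary *)

Section exterior_cone.
Context (R : realType) (n : nat).
Implicit Types (x y z : 'rV[R]_n) (C : set 'rV[R]_n).

Lemma convex_set_comb C x y (t : R) :
  convex_set (C : set (convex_lmodType 'rV[R]_n)) -> C x -> C y ->
  0 <= t <= 1 -> C (t *: x + (1 - t) *: y).
Proof.
move=> convC Cx Cy t01.
have [k kt] : exists k : {i01 R}, k%:num = t.
  have h : Itv.spec (@Itv.num_sem R) (Itv.Real `[0%Z, 1%Z]) t.
    by rewrite /= /Itv.num_sem /= num_real /= in_itv /= t01.
  by exists (Itv.mk h).
have := convC x y k (mem_set Cx) (mem_set Cy).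
by rewrite inE /conv /= /convex_lmodType kt; apply.
Qed.

(* If a point q of ball p (t * rho), p := x + t (x - z), were in the closure of C,
   then x would be a proper convex combination of q and of a point of ball z rho. *)
Lemma convex_exterior_ball C x z (rho L r : R) :
  convex_set (C : set (convex_lmodType 'rV[R]_n)) -> ball z rho `<=` C ->
  0 < rho -> ~ C x -> `|x - z| + rho <= L -> 0 < r ->
  exists p, ball p (rho / L * r) `<=` ball x r `\` closure C.
Proof.
move=> convC zC rho0 Cx xzL r0.
have L0 : 0 < L by apply: lt_le_trans xzL; rewrite ltr_wpDl.
(* With this t, t (|x - z| + rho) <= r, so the small ball stays in [ball x r]. *)
pose t := r / L; have t0 : 0 < t by rewrite divr_gt0.
have trho : rho / L * r = t * rho by rewrite /t; field; rewrite gt_eqF.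
exists (x + t *: (x - z)); rewrite trho => q; rewrite !ball_rowE /= => pq; split.
  apply: le_lt_trans (ler_distD (x + t *: (x - z)) _ _) _.
  rewrite opprD addrA subrr add0r normrN normrZ gtr0_norm//.
  apply: (@lt_le_trans _ _ (t * `|x - z| + t * rho)); first by rewrite ltrD2l.
  by rewrite -mulrDr /t mulrAC ler_pdivrMr// ler_pM2l.
move=> cq; apply: Cx.
(* As q is only in the closure, it is replaced by a point q' of C within this slack, still in the
   small ball. *)
pose e := t * rho - `|x + t *: (x - z) - q|.
have e0 : 0 < e by rewrite subr_gt0.
have [q' [Cq' qq']] := cq _ (nbhsx_ballx q e e0).
move: qq'; rewrite ball_rowE /= => qq'.
pose w := x + t^-1 *: (x - q').
have Cw : C w.
  apply: zC; rewrite ball_rowE /= /w.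
  have -> : z - (x + t^-1 *: (x - q')) = - (t^-1 *: (x + t *: (x - z) - q')).
    by apply/rowP => k; rewrite !mxE; field; rewrite gt_eqF.
  rewrite normrN normrZ gtr0_norm ?invr_gt0// mulrC ltr_pdivrMr// mulrC.
  apply: le_lt_trans (ler_distD q _ _) _.
  by rewrite -ltrBrDl.
have -> : x = (1 + t)^-1 *: q' + (1 - (1 + t)^-1) *: w.
  by apply/rowP => k; rewrite !mxE; field; rewrite !gt_eqF// ltr_wpDr// ltW.
apply: convex_set_comb => //.
by rewrite invr_ge0 invf_le1 ?lerDl ?addr_ge0 ?ltr_wpDr// ltW.
Qed.

End exterior_cone.

Section density_scale.
Context (R : realType) (n : nat).
Let N := n.+2.
Variables (A w : set 'rV[R]_N) (c beta : R).
Hypothesis A_open : open A.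
Hypothesis w_open : open w.
Let V := A `\` closure w.
Let S := tboundary w `&` A.
(** The 1 stands for the boundary of w. The rest comes from [good_slice] with volume 2 beta^(n+1)
    r^N on an interval of length r / 2. *)
Let M : R := 1 + 4 * slice_const R n.
Hypothesis isoA : forall (u : set 'rV[R]_N) (y : R), open u -> u `<=` A -> 0 <= y ->
  (hausdorff n.+1 (tboundary u `&` A) <= (y ^+ n.+1)%:E)%E ->
  (mine (leb u) (leb (A `\` u)) <= (c * y ^+ N)%:E)%E.
Hypothesis beta_gt0 : 0 < beta.
Hypothesis beta_small : c * (2 * M) ^+ N * beta <= 1.
Hypothesis V_small : (leb V <= (beta ^+ n.+1)%:E)%E.
Hypothesis V_minor : (leb V + leb V <= leb A)%E.

Let V_open : open V.
Proof. by apply: openI => //; apply: closed_openC; exact: closed_closure. Qed.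

Let M_ge1 : 1 <= M.
Proof. by rewrite lerDl mulr_ge0// ltW// slice_const_gt0. Qed.

(** A point of A outside [closure w] is interior to V, so only the sphere can put it on the
    boundary. Points of the sphere in [closure w] go to the first term, whose ball is larger. *)
Lemma tboundary_cut (x : 'rV[R]_N) (rho r : R) : rho < r ->
  tboundary (V `&` ball x rho) `&` A `<=`
    (S `&` ball x r) `|` ((V `&` ball x r) `&` [set z | `|x - z| = rho]).
Proof.
move=> rr z [[cz nz] Az].
have [cVz cBz] := closureI cz.
have xz : `|x - z| <= rho.
  rewrite leNgt; apply/negP => rxz.
  have e0 : 0 < `|x - z| - rho by rewrite subr_gt0.
  have [q [Bq zq]] := cBz _ (nbhsx_ballx z _ e0).
  move: Bq zq; rewrite !ball_rowE /= => xq zq.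
  have := ler_distD q x z; rewrite [`|q - z|]distrC; lra.
have Bz : ball x r z by rewrite ball_rowE /=; apply: le_lt_trans rr.
have [cwz|cwz] := pselect (closure w z).
  left; split => //; split => //; split => //.
  move=> /interior_subset wz.
  have [q [[_ cwq] wq]] := cVz _ (open_nbhs_nbhs (conj w_open wz)).
  exact/cwq/subset_closure.
right; split => //=; apply/eqP; rewrite eq_le xz /= leNgt; apply/negP => xzr.
apply: nz; apply: open_nbhs_nbhs; split; last by split => //; rewrite ball_rowE.
by apply: openI => //; exact: ball_open.
Qed.

(* The cut is made at a good radius between r / 2 and r; since the isoperimetric
   inequality is superlinear, the density does not increase if it is small enough. *)
Lemma density_step (x : 'rV[R]_N) (r : R) : 0 < r ->
  (hausdorff n.+1 (S `&` ball x r) <= ((beta * r) ^+ n.+1)%:E)%E ->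
  (leb (V `&` ball x r) <= (beta ^+ n.+1 * r ^+ N)%:E)%E ->
  (leb (V `&` ball x (r / 2)) <= (beta ^+ n.+1 * (r / 2) ^+ N)%:E)%E.
Proof.
move=> r0 HS HV.
pose v := 2 * (beta ^+ n.+1 * r ^+ N).
have v0' : 0 < beta ^+ n.+1 * r ^+ N by rewrite mulr_gt0// exprn_gt0.
have v0 : 0 < v by rewrite mulr_gt0.
have Vv : (leb (V `&` ball x r) < v%:E)%E.
  by apply: le_lt_trans HV _; rewrite lte_fin /v ltr_pMl// ltr1n.
have r2r : r / 2 < r by rewrite ltr_pdivrMr// ltr_pMr// ltr1n.
have [rho /andP[rho1 rho2] Hrho] := good_slice x Vv v0 r2r.
pose u := V `&` ball x rho.
have uo : open u by apply: openI => //; exact: ball_open.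
have uA : u `<=` A by move=> z [[]].
have y0 : 0 <= M * (beta * r).
  by rewrite mulr_ge0 ?(le_trans ler01 M_ge1)// mulr_ge0// ltW.
have Hu : (hausdorff n.+1 (tboundary u `&` A) <= ((M * (beta * r)) ^+ n.+1)%:E)%E.
  apply: le_trans (le_hausdorff _ (tboundary_cut rho2)) _.
  apply: le_trans (hausdorffU _ _ _) _ => //.
  apply: le_trans (leeD HS Hrho) _.
  rewrite -EFinD lee_fin (_ : slice_const R n * v / (r - r / 2) =
      4 * slice_const R n * (beta * r) ^+ n.+1); last first.
    by rewrite /v /N exprMn [r ^+ n.+2]exprS; field; lra.
  rewrite -[X in X + _]mul1r -mulrDl -/M [leRHS]exprMn.
  rewrite ler_wpM2r ?exprn_ge0// ?mulr_ge0 ?(ltW beta_gt0) ?(ltW r0)//.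
  have M0 : 0 <= M by exact: le_trans ler01 M_ge1.
  by rewrite exprS ler_peMr// exprn_ege1.
have leuV : (leb u <= leb V)%E by apply: leb_le => z [].
have Vfin : leb V \is a fin_num.
  by rewrite ge0_fin_numE ?leb_ge0// (le_lt_trans V_small)// ltry.
(* By [V_minor] the cut piece is at most half of A, so isoperimetry bounds the piece and not its
   complement. *)
have lebmin : (leb u <= leb (A `\` u))%E.
  apply: (le_trans leuV).
  have : (leb V + leb V <= leb V + leb (A `\` u))%E.
    apply: le_trans V_minor _.
    apply: (@le_trans _ _ (leb u + leb (A `\` u))%E); last exact: leeD2r.
    apply: le_trans (outer_measureU2 _ _ _) => //.
    by apply: leb_le => z Az; have [uz|uz] := pselect (u z); [left|right].
  by rewrite leeD2lE.
have := isoA uo uA y0 Hu; rewrite (min_idPl lebmin) => lebu.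
apply: (@le_trans _ _ (leb u)).
  apply: leb_le => z [Vz xz]; split => //; move: xz; rewrite !ball_rowE /=.
  by move=> /lt_trans; apply.
apply: le_trans lebu _; rewrite lee_fin.
(* The power N yields one factor beta more than the density beta^(n+1) requires; by [beta_small] it
   absorbs c (2 M)^N. *)
rewrite (_ : c * _ = c * (2 * M) ^+ N * beta * (beta ^+ n.+1 * (r / 2) ^+ N)).
  rewrite ler_piMl// mulr_ge0 ?exprn_ge0 ?divr_ge0 ?(ltW beta_gt0) ?(ltW r0)//.
rewrite /N !exprMn exprVn [beta ^+ n.+2]exprS; field.
by rewrite expf_neq0.
Qed.

(** The scale [r1] below which V is dense at x depends on x and has no lower bound. Hence the
    halving starts at scale 1, where [V_small] suffices, and goes on until it passes [r1]. *)
Lemma density_scale (x : 'rV[R]_N) (r1 : R) : 0 < r1 ->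
  (forall r, 0 < r -> r < r1 ->
    ((beta ^+ n.+1 * r ^+ N)%:E < leb (V `&` ball x r))%E) ->
  exists2 r, 0 < r <= 1 &
    (((beta * r) ^+ n.+1)%:E < hausdorff n.+1 (S `&` ball x r))%E.
Proof.
move=> r10 dense; apply: contrapT => none.
have small r : 0 < r -> r <= 1 ->
    (hausdorff n.+1 (S `&` ball x r) <= ((beta * r) ^+ n.+1)%:E)%E.
  move=> r0 r1'; rewrite leNgt; apply/negP => h; apply: none.
  by exists r; rewrite ?r0.
have dyadic k : (leb (V `&` ball x (2^-1 ^+ k)) <=
    (beta ^+ n.+1 * (2^-1 ^+ k) ^+ N)%:E)%E.
  elim: k => [|k IH].
    rewrite expr0 expr1n mulr1; apply: le_trans V_small.
    by apply: leb_le => z [].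
  have k0 : 0 < 2^-1 ^+ k :> R by rewrite exprn_gt0// invr_gt0.
  rewrite (exprSr 2^-1 k); apply: density_step => //; apply: small => //.
  by rewrite exprn_ile1// invf_le1// ler1n.
have [k] := filter_ex (near_infty_natSinv_expn_lt (PosNum r10)).
rewrite div1r -exprVn /= => kr.
have k0 : 0 < 2^-1 ^+ k :> R by rewrite exprn_gt0// invr_gt0.
by have := dense _ k0 kr; rewrite ltNge dyadic.
Qed.

End density_scale.

(** * The competitor *)

Section competitor_boundary.
Context (R : realType) (V : normedModType R).
Implicit Types (w A Omega D : set V) (r rho : V -> R).

(** Infinitely many balls could create boundary off the spheres, at limits of balls with radii
    tending to 0. Such limits are limits of centres, hence in [closure A], and there the points of
    Omega are in A, in [closure w] or covered. *)
Lemma tboundary_fill w A Omega D rho :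
  open w -> open A -> open Omega ->
  (forall x, D x -> closure A x) ->
  (forall x, Omega x -> closure A x -> ~ A x -> ~ closure w x ->
     exists2 y, D y & ball y (rho y) x) ->
  (forall e, 0 < e -> finite_set [set x | D x /\ e <= rho x]) ->
  tboundary (w `|` A `|` (Omega `&` \bigcup_(x in D) ball x (rho x))) `&` Omega
    `<=` (tboundary w `&` Omega) `|` \bigcup_(x in D) [set z | `|x - z| = rho x].
Proof.
move=> ow oA oO DA cover fin x [[cx nx] Ox].
have xt : ~ (w `|` A `|` (Omega `&` \bigcup_(x in D) ball x (rho x))) x.
  move=> h; apply: nx; apply: open_nbhs_nbhs; split => //.
  apply: openU; first exact: openU.
  by apply: openI => //; apply: bigcup_open => z _; exact: ball_open.
have [cwx|cwx] := pselect (closure w x).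
  left; split => //; split => // /interior_subset wx; apply: xt.
  by left; left.
right; apply: contrapT => nsph.
have Dout z : D z -> rho z < `|z - x|.
  move=> Dz; rewrite lt_neqAle; apply/andP; split.
    by apply/eqP => e; apply: nsph; exists z.
  rewrite leNgt; apply/negP => zx; apply: xt; right; split => //.
  by exists z => //; rewrite -ball_normE.
have [cAx|cAx] := pselect (closure A x).
  have [|y Dy yx] := cover x Ox cAx _ cwx.
    by move=> Ax; apply: xt; left; right.
  by apply: xt; right; split => //; exists y.
have far (U : set V) : ~ closure U x -> exists2 d, 0 < d & forall z, `|x - z| < d -> ~ U z.
  move=> cU; have /nbhs_ballP[d /= d0 dU] : nbhs x (~` closure U).
    by apply: open_nbhs_nbhs; split => //; apply: closed_openC; exact: closed_closure.
  exists d => // z xz Uz; have := dU z; rewrite -ball_normE /= => /(_ xz).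
  by apply; exact: subset_closure.
have [d1 d10 d1w] := far _ cwx.
have [d2 d20 d2A] := far _ cAx.
have Dfar z : D z -> d2 <= `|x - z|.
  move=> Dz; rewrite leNgt; apply/negP => xz.
  have e0 : 0 < d2 - `|x - z| by rewrite subr_gt0.
  have [q [Aq zq]] := DA z Dz _ (nbhsx_ballx z _ e0).
  apply: (d2A q) => //; move: zq; rewrite -ball_normE /= => zq.
  by apply: le_lt_trans (ler_distD z _ _) _; rewrite -ltrBrDl.
have d22 : 0 < d2 / 2 by rewrite divr_gt0.
(* Centres are at distance at least d2 from x, so balls of radius below d2 / 2 stay away from x; the
   finitely many others are treated one by one. *)
have /finite_seqP[s sE] := fin _ d22.
have [d3 d30 d3s] : exists2 d, 0 < d & forall z, z \in s -> d <= `|z - x| - rho z.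
  have : forall z, z \in s -> D z.
    by move=> z zs; have : [set` s] z by []; rewrite -sE => -[].
  elim: s {sE} => [_|z s IH sD]; first by exists 1.
  have [|d d0 ds] := IH; first by move=> y ys; apply: sD; rewrite inE ys orbT.
  exists (Num.min d (`|z - x| - rho z)).
    by rewrite lt_min d0 subr_gt0 Dout//; apply: sD; exact: mem_head.
  by move=> y; rewrite inE ge_min => /predU1P[->|/ds ->//]; rewrite lexx orbT.
have d0 : 0 < Num.min (Num.min d1 d2) (Num.min (d2 / 2) d3).
  by rewrite !lt_min d10 d20 d22 d30.
have [q [wq xq]] := cx _ (nbhsx_ballx x _ d0).
move: xq; rewrite -ball_normE /= !lt_min => /andP[/andP[xq1 xq2] /andP[xq22 xq3]].
case: wq => [[wq|Aq]|[_ [z Dz]]]; [exact: (d1w q)|exact: (d2A q)|].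
rewrite -ball_normE /= => zq.
have := ler_distD q z x; rewrite [`|q - x|]distrC => zqx.
have [zs|zs] := boolP (z \in s).
  have := d3s z zs; lra.
have rz : rho z < d2 / 2.
  rewrite ltNge; apply/negP => h; move/negP: zs; apply.
  by have : [set z | D z /\ d2 / 2 <= rho z] z by []; rewrite sE.
have := Dfar z Dz; rewrite distrC; lra.
Qed.

End competitor_boundary.

Section filling.
Context (R : realType) (n : nat).
Let N := n.+2.
Variables (Omega K A : set 'rV[R]_N) (c c2 theta beta mA : R).
Let M : R := 1 + 4 * slice_const R n.
Hypothesis Omega_open : open Omega.
Hypothesis A_open : open A.
Hypothesis AE : Omega `\` K = A.
Hypothesis isoA : forall (u : set 'rV[R]_N) (y : R), open u -> u `<=` A -> 0 <= y ->
  (hausdorff n.+1 (tboundary u `&` A) <= (y ^+ n.+1)%:E)%E ->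
  (mine (leb u) (leb (A `\` u)) <= (c * y ^+ N)%:E)%E.
Hypothesis isoOmega : forall (u : set 'rV[R]_N) (y : R), open u -> u `<=` Omega ->
  u `\` K = A -> 0 <= y -> (perimeter u Omega <= (y ^+ n.+1)%:E)%E ->
  (leb (Omega `\` u) <= (c2 * y ^+ N)%:E)%E.
Hypothesis cone : forall (x : 'rV[R]_N) (r : R), closure A x -> ~ A x -> Omega x -> 0 < r ->
  (((theta * r) ^+ N)%:E <= leb (ball x r `\` K))%E.
Hypothesis beta_gt0 : 0 < beta.
Hypothesis beta_small : c * (2 * M) ^+ N * beta <= 1.
Hypothesis beta_theta : beta ^+ n.+1 < theta ^+ N.
Hypothesis mA_le : A !=set0 -> (mA%:E <= leb A)%E.

(** From [good_slice] with the volume bound 2 (24 r)^N for the ball of radius 12 r, on an interval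
    of length 6 r. *)
Definition sphere_const : R := slice_const R n * (2 * 24 ^+ N) / 6.

(* The factor 6 comes from vitali_selection, which is applied to the radii 2 * r. *)
Lemma good_sphere (x : 'rV[R]_N) (r : R) : 0 < r ->
  exists2 rho, 6 * r < rho < 12 * r &
    (hausdorff n.+1 [set z | `|x - z| = rho]%R <= (sphere_const * r ^+ n.+1)%:E)%E.
Proof.
move=> r0; pose v := 2 * (2 * (12 * r)) ^+ N.
have r12 : 0 < 2 * (12 * r) by rewrite !mulr_gt0.
have Bv : (leb (ball x (12 * r)) < v%:E)%E.
  apply: le_lt_trans (leb_ball_le _ _) _; first by rewrite mulr_ge0// ltW.
  by rewrite lte_fin /v ltr_pMl ?ltr1n// exprn_gt0.
have v0 : 0 < v by rewrite mulr_gt0// exprn_gt0.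
have r6 : 6 * r < 12 * r by rewrite ltr_pM2r// ltr_nat.
have [t t612 Ht] := good_slice x Bv v0 r6.
exists t => //; apply: le_trans (le_trans (le_hausdorff _ _) Ht) _.
  move=> z /= xz; split => //; rewrite ball_rowE /= xz.
  by case/andP: t612.
rewrite lee_fin /v /sphere_const.
rewrite (_ : 2 * (12 * r) = 24 * r); last by ring.
rewrite exprMn /N [r ^+ n.+2]exprS.
rewrite [leLHS](_ : _ = slice_const R n * (2 * 24 ^+ n.+2) / 6 * r ^+ n.+1)//.
by field; rewrite gt_eqF// subr_gt0.
Qed.

(** The inner sum accounts for the boundary of w and for the spheres. The leading 1 makes the
    constant at most its own power n + 1, which bounds the perimeter in the form required by
    [isoOmega]. *)
Definition fill_const : R := 1 + perimeter_const R n * (1 + sphere_const / beta ^+ n.+1).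

Definition filling_const : R := c2 * fill_const ^+ N + c + (24 / beta) ^+ N.

(** Omega \ w splits into the part outside the competitor, A \ w, and the part in the added balls;
    these are the three terms of [filling_const]. The two smallness assumptions supply [V_small] and
    [V_minor] for the density argument. *)
Lemma leb_complement_le (w : set 'rV[R]_N) (y : R) : open w -> w `<=` Omega -> 0 <= y ->
  (hausdorff n.+1 (tboundary w `&` Omega) <= (y ^+ n.+1)%:E)%E ->
  (leb (A `\` w) <= (c * y ^+ N)%:E)%E ->
  c * y ^+ N <= beta ^+ n.+1 -> 2 * (c * y ^+ N) <= mA ->
  (leb (Omega `\` w) <= (filling_const * y ^+ N)%:E)%E.
Proof.
move=> ow wO y0 Hw Aw small1 small2.
have AO : A `<=` Omega by rewrite -AE => x [].
pose V := A `\` closure w; pose S := tboundary w `&` A.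
have HS : (hausdorff n.+1 S <= (y ^+ n.+1)%:E)%E.
  by apply: le_trans (le_hausdorff _ _) Hw => x [wx /AO].
have Vc : (leb V <= (c * y ^+ N)%:E)%E.
  apply: le_trans (leb_le _) Aw => x [Ax cwx]; split => // wx.
  exact/cwx/subset_closure.
pose P := [set x | [/\ Omega x, closure A x, ~ A x & ~ closure w x]].
have [r rP] : {r : 'rV[R]_N -> R & forall x, P x -> 0 < r x <= 1 /\
    (((beta * r x) ^+ n.+1)%:E < hausdorff n.+1 (S `&` ball x (r x)))%E}.
  apply: (@choice _ _ (fun x r => P x -> 0 < r <= 1 /\
    (((beta * r) ^+ n.+1)%:E < hausdorff n.+1 (S `&` ball x r))%E)) => x.
  have [Px|] := pselect (P x); last by exists 0.
  have [Ox cAx nAx cwx] := Px.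
  have VA : (leb V + leb V <= leb A)%E.
    apply: le_trans (leeD Vc Vc) _; rewrite -EFinD.
    have [q [Aq _]] := cAx _ (nbhsx_ballx x 1 ltr01).
    apply: le_trans (mA_le _); last by exists q.
    by rewrite lee_fin; apply: le_trans small2; rewrite mulr_natl mulr2n.
  have Vb : (leb V <= (beta ^+ n.+1)%:E)%E by apply: le_trans Vc _; rewrite lee_fin.
  (* Near x everything outside K lies in V, so the cone estimate is a lower density bound for V. *)
  have : nbhs x (Omega `\` closure w).
    apply: open_nbhs_nbhs; split => //; apply: openI => //.
    by apply: closed_openC; exact: closed_closure.
  move=> /nbhs_ballP[r1 /= r10 r1O].
  have [t t0|r r01 Hr] := density_scale A_open ow isoA beta_gt0 beta_small Vb VA r10 (x := x).
    move=> tr1; apply: (@lt_le_trans _ _ ((theta * t) ^+ N)%:E).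
      by rewrite lte_fin exprMn ltr_pM2r// exprn_gt0.
    apply: le_trans (cone cAx nAx Ox _) _ => //; apply: leb_le => z [xz Kz].
    have [Oz cwz] : (Omega `\` closure w) z.
      apply: r1O; move: xz; rewrite !ball_rowE /= => /lt_trans; exact.
    by split => //; split => //; rewrite -AE.
  by exists r.
have r0 x : P x -> 0 < r x by move=> /rP[/andP[]].
have r20 x : P x -> 0 < 2 * r x by move=> /r0 h; rewrite mulr_gt0.
have r2M x : P x -> 2 * r x <= 2 by move=> /rP[/andP[_ h] _]; rewrite ler_piMr.
(* Doubled radii are used, as [hausdorff_disjoint_balls] asks for disjoint doubled balls. *)
have [D [DP Ddisj Dcov]] := vitali_selection r20 r2M.
have Dr0 x : D x -> 0 < r x by move=> /DP /r0.
pose a x := (beta * r x) ^+ n.+1.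
have a0 x : D x -> 0 < a x by move=> Dx; rewrite exprn_gt0// mulr_gt0// Dr0.
have asum (u : seq 'rV[R]_N) : uniq u -> (forall x, x \in u -> D x) ->
    \sum_(x <- u) a x <= y ^+ n.+1.
  move=> uu uD; rewrite -lee_fin; apply: le_trans HS.
  apply: (hausdorff_disjoint_balls (s := n.+1) _ (c := id) (r := r)) => //.
  - by move=> x xu; apply: Dr0; exact: uD.
  - by move=> x z xu zu xz; apply: Ddisj => //; exact: uD.
  - by move=> x xu; have [] := rP x (DP x (uD x xu)).
have [e [eD De esum]] := summable_enumeration a0 asum.
have [rho rhoP] : {rho : 'rV[R]_N -> R & forall x, D x -> 6 * r x < rho x < 12 * r x /\
    (hausdorff n.+1 [set z | `|x - z| = rho x]%R <= (sphere_const * r x ^+ n.+1)%:E)%E}.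
  apply: (@choice _ _ (fun x rho => D x -> 6 * r x < rho < 12 * r x /\
    (hausdorff n.+1 [set z | `|x - z| = rho]%R <= (sphere_const * r x ^+ n.+1)%:E)%E)) => x.
  have [Dx|] := pselect (D x); last by exists 0.
  by have [t t1 t2] := good_sphere x (Dr0 x Dx); exists t.
pose U := \bigcup_(x in D) ball x (rho x).
pose w' := w `|` A `|` (Omega `&` U).
have w'o : open w'.
  apply: openU; first exact: openU.
  by apply: openI => //; apply: bigcup_open => z _; exact: ball_open.
have w'O : w' `<=` Omega by move=> x [[/wO|/AO]|[]].
have w'A : w' `\` K = A.
  apply/seteqP; split => x; first by move=> [/w'O Ox Kx]; rewrite -AE.
  by move=> Ax; split; [left; right|move: Ax; rewrite -AE => -[]].
have bd : tboundary w' `&` Omega `<=`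
    (tboundary w `&` Omega) `|` \bigcup_(x in D) [set z | `|x - z| = rho x].
  apply: tboundary_fill => //.
  - by move=> x /DP[].
  - move=> x Ox cAx nAx cwx; have [|z Dz zx] := Dcov x; first by split.
    exists z => //; move: zx; rewrite !ball_rowE /= => /lt_trans; apply.
    by have [/andP[+ _] _] := rhoP z Dz; rewrite mulrA -natrM.
  - move=> t t0.
    (* If rho x >= t then r x > t / 12, which bounds the summable term a x from below. *)
    have t120 : 0 < (beta * (t / 12)) ^+ n.+1 by rewrite exprn_gt0// mulr_gt0// divr_gt0.
    apply: (sub_finite_set _ (finite_large_terms asum t120)) => x [Dx tx].
    split => //; rewrite /a lerXn2r ?nnegrE ?mulr_ge0 ?divr_ge0 ?(ltW t0)
      ?(ltW beta_gt0) ?(ltW (Dr0 x Dx))//.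
    rewrite ler_pM2l// ler_pdivrMr// mulrC; apply/ltW/(le_lt_trans tx).
    by have [/andP[]] := rhoP x Dx.
have bn0 : 0 < beta ^+ n.+1 by rewrite exprn_gt0.
have sc0 : 0 < sphere_const.
  by rewrite divr_gt0// mulr_gt0 ?slice_const_gt0// mulr_gt0// exprn_gt0.
have aE x : r x ^+ n.+1 = a x / beta ^+ n.+1.
  by rewrite /a exprMn mulrAC mulfV ?mul1r// gt_eqF.
have oa0 k : 0 <= oapp a 0 (e k).
  by case ek: (e k) => [x|]//=; apply/ltW/a0/(eD k).
have Hsph : (hausdorff n.+1 (\bigcup_(x in D) [set z | `|x - z| = rho x]%R) <=
    (sphere_const / beta ^+ n.+1 * y ^+ n.+1)%:E)%E.
  pose Sk k := oapp (fun x => [set z | `|x - z| = rho x]) set0 (e k).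
  apply: (@le_trans _ _ (hausdorff n.+1 (\bigcup_k Sk k))).
    apply: le_hausdorff => z [x Dx xz]; have [k ek] := De x Dx.
    by exists k => //; rewrite /Sk ek.
  apply: le_trans (@hausdorff_sigma_subadditive _ _ n.+1 Sk) _.
  apply: (@le_trans _ _ (\sum_(k <oo) ((sphere_const / beta ^+ n.+1)%:E * (oapp a 0 (e k))%:E))%E).
    apply: lee_nneseries => [k _ _|k _]; first exact: hausdorff_ge0.
    rewrite -EFinM /Sk; case ek: (e k) => [x|] /=; last by rewrite hausdorff_set0// mulr0.
    have [_ h] := rhoP x (eD _ _ ek); apply: le_trans h _.
    by rewrite lee_fin aE mulrA mulrAC.
  rewrite nneseriesZl; last by move=> k _; rewrite lee_fin.
  by rewrite [leRHS]EFinM lee_wpmul2l// lee_fin divr_ge0 ?ltW.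
have fc1 : 1 <= fill_const.
  rewrite lerDl mulr_ge0 ?(ltW (perimeter_const_gt0 _ _))// addr_ge0//.
  by rewrite divr_ge0 ?ltW.
have perim : (perimeter w' Omega <= ((fill_const * y) ^+ n.+1)%:E)%E.
  apply: le_trans (perimeter_le_hausdorff _ w'o) _.
  apply: (@le_trans _ _ ((perimeter_const R n)%:E *
     ((y ^+ n.+1)%:E + (sphere_const / beta ^+ n.+1 * y ^+ n.+1)%:E))%E).
    rewrite lee_wpmul2l ?lee_fin ?(ltW (perimeter_const_gt0 _ _))//.
    apply: le_trans (le_hausdorff _ bd) _.
    apply: le_trans (hausdorffU _ _ _) _ => //; exact: leeD.
  rewrite -EFinD -EFinM lee_fin exprMn -[X in X + _]mul1r -mulrDl mulrA.
  rewrite ler_wpM2r ?exprn_ge0//.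
  apply: (@le_trans _ _ fill_const); first by rewrite /fill_const lerDr.
  by rewrite exprS ler_peMr ?(le_trans ler01)// exprn_ege1.
have fy0 : 0 <= fill_const * y by rewrite mulr_ge0// (le_trans ler01).
have main := isoOmega w'o w'O w'A fy0 perim.
have balls : (leb U <= ((24 / beta) ^+ N * y ^+ N)%:E)%E.
  pose Bk k := oapp (fun x => ball x (rho x)) set0 (e k).
  apply: (@le_trans _ _ (leb (\bigcup_k Bk k))).
    apply: leb_le => z [x Dx xz]; have [k ek] := De x Dx.
    by exists k => //; rewrite /Bk ek.
  apply: le_trans (leb_sigma_subadditive _) _.
  apply: (@le_trans _ _ (\sum_(k <oo) (((24 / beta) ^+ N * y)%:E * (oapp a 0 (e k))%:E))%E).
    apply: lee_nneseries => [k _ _|k _]; first exact: leb_ge0.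
    rewrite -EFinM /Bk; case ek: (e k) => [x|] /=; last by rewrite leb_set0 mulr0.
    have Dx := eD _ _ ek; have rx := Dr0 x Dx.
    have [/andP[h6 h12] _] := rhoP x Dx.
    have rho0 : 0 <= rho x by apply/ltW/(lt_trans _ h6); rewrite mulr_gt0.
    apply: le_trans (leb_ball_le _ rho0) _; rewrite lee_fin.
    (* A single term of the sum is at most y^(n+1). In (beta r)^N one factor is bounded by y, and
       the remaining n + 1 factors are summed. *)
    have bry : beta * r x <= y.
      have := asum [:: x] isT; rewrite big_seq1 => /(_ _) h.
      rewrite -(@ler_pXn2r _ n.+1)// ?nnegrE//.
        by apply: h => z; rewrite inE => /eqP ->.
      by rewrite mulr_ge0// ltW.
    apply: (@le_trans _ _ ((24 * r x) ^+ N)).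
      rewrite lerXn2r ?nnegrE ?mulr_ge0// ?(ltW rx)//.
      by rewrite (_ : 24 * r x = 2 * (12 * r x)) ?ler_pM2l// ?ltW//; ring.
    rewrite (_ : 24 * r x = 24 / beta * (beta * r x)); last by field; rewrite gt_eqF.
    rewrite exprMn -[leRHS]mulrA ler_wpM2l ?exprn_ge0 ?divr_ge0 ?(ltW beta_gt0)//.
    by rewrite /N exprS ler_wpM2r// ltW// a0.
  rewrite nneseriesZl; last by move=> k _; rewrite lee_fin.
  rewrite (_ : (24 / beta) ^+ N * y ^+ N = (24 / beta) ^+ N * y * y ^+ n.+1).
    rewrite [leRHS]EFinM lee_wpmul2l// lee_fin mulr_ge0// exprn_ge0// divr_ge0//.
    exact: ltW.
  by rewrite -mulrA -exprS.
apply: (@le_trans _ _ (leb ((Omega `\` w') `|` (A `\` w) `|` U))).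
  apply: leb_le => x [Ox wx].
  have [w'x|w'x] := pselect (w' x); last by left; left.
  by case: w'x => [[//|Ax]|[_ Ux]]; [left; right|right].
apply: le_trans (outer_measureU2 _ _ _) _.
apply: le_trans (leeD (outer_measureU2 _ _ _) (lexx _)) _.
apply: le_trans (leeD (leeD main Aw) balls) _.
rewrite -!EFinD lee_fin /filling_const (exprMn N fill_const y).
set q := fill_const; rewrite le_eqVlt; apply/orP; left; apply/eqP; ring.
Qed.

End filling.

(** * The isoperimetric inequality for [Omega] *)

Lemma powR_expr_ratio (R : realType) (n : nat) (y : R) : 0 <= y ->
  (y ^+ n.+1) `^ (n.+2%:R / n.+1%:R) = y ^+ n.+2.
Proof.
move=> y0; rewrite -powR_mulrn// -powRrM mulrCA mulfV ?pnatr_eq0// mulr1.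
by rewrite powR_mulrn.
Qed.

Lemma poweR_expr_ratio_le (R : realType) (n : nat) (y : R) (x : \bar R) : 0 <= y ->
  (0 <= x)%E -> (x <= (y ^+ n.+1)%:E)%E ->
  (x `^ (n.+2%:R / n.+1%:R) <= (y ^+ n.+2)%:E)%E.
Proof.
move=> y0 x0 xy; rewrite -(powR_expr_ratio n y0) -poweR_EFin.
by apply: gt0_ler_poweR => //; rewrite in_itv/= ?leey ?andbT// lee_fin exprn_ge0.
Qed.

Section main.
Context (R : realType) (n : nat).
Let N := n.+2.

(* Boundary measures are bounded by y ^+ (N - 1) for a length y, so that the exponent
   N / (N - 1) disappears. *)
Lemma isoperimetry_domain_expr (A : set 'rV[R]_N) : isoperimetry_domain A ->
  open A /\ exists2 c : R, 0 < c & forall (u : set 'rV[R]_N) (y : R),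
    open u -> u `<=` A -> 0 <= y ->
    (hausdorff n.+1 (tboundary u `&` A) <= (y ^+ n.+1)%:E)%E ->
    (mine (leb u) (leb (A `\` u)) <= (c * y ^+ N)%:E)%E.
Proof.
move=> [oA [c c0 iso]]; split => //; exists c => // u y ou uA y0 Hy.
apply: le_trans (iso u ou uA) _; rewrite EFinM lee_wpmul2l ?lee_fin ?(ltW c0)//.
by apply: poweR_expr_ratio_le => //; exact: hausdorff_ge0.
Qed.

Lemma closure_norm_le (D : set 'rV[R]_N) (M : R) :
  (forall x, D x -> `|x| <= M) -> forall x, closure D x -> `|x| <= M + 1.
Proof.
move=> DM x cx; have [q [Dq xq]] := cx _ (nbhsx_ballx x 1 ltr01).
move: xq; rewrite ball_rowE /= => xq; have := DM q Dq.
have := ler_normD (x - q) q; rewrite subrK; lra.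
Qed.

Lemma open_leb_lower (A : set 'rV[R]_N) : open A ->
  exists2 m : R, 0 < m & (A !=set0 -> (m%:E <= leb A)%E).
Proof.
move=> oA; have [[x Ax]|A0] := pselect (A !=set0); last by exists 1.
have /nbhs_ballP[r /= r0 rA] := open_nbhs_nbhs (conj oA Ax).
exists (r ^+ N) => [|_]; first by rewrite exprn_gt0.
exact: le_trans (leb_ball_ge x r0) (leb_le rA).
Qed.

End main.

Lemma perimeter_ge0 (R : realType) (n : nat) (E U : set 'rV[R]_n) :
  (0 <= perimeter E U)%E.
Proof.
have J0 x : jacobian (fun=> 0 : 'rV[R]_n) x = 0 :> 'M[R]_n.
  by apply/matrixP => i j; rewrite /jacobian diff_cst !mxE.
apply: ereal_sup_ubound; exists (fun=> 0).
  split; last by move=> x; rewrite /enorm big1 ?sqrtr0// => i _; rewrite mxE expr0n.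
  split; first by move=> x; exact: differentiable_cst.
    by under eq_fun do rewrite J0; exact: cst_continuous.
  by exists set0; split => //; exact: compact0.
apply: (@integral0_eq _ _ _ (caratheodory_measure (@leb R n))) => x _.
by rewrite /divergence J0 mxtrace0.
Qed.

Theorem lemma5p4 (R : realType) (N : nat) (hN : (2 <= N)%N)
    (D C E0 : set 'rV[R]_N) (hH : hypothesisH D C E0)
    (Omega : set 'rV[R]_N) (Omega_open : open Omega)
    (Omega_bc : Omega `\` closure C = E0 `\` closure C)
    (hOmega : exists2 c : R, 0 < c &
       forall omega : set 'rV[R]_N,
         open omega -> omega `<=` Omega ->
         omega `\` closure C = E0 `\` closure C ->
         (leb (Omega `\` omega) <=
          c%:E * (perimeter omega Omega `^ (N%:R / N.-1%:R)))%E) :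
  isoperimetry_domain Omega.
Proof.
case: N hN D C E0 hH Omega Omega_open Omega_bc hOmega => [//|[//|n]] _.
move=> D C E0 hH Omega oO Obc [c2 c20 isoO].
set N := n.+2; set K := closure C; set A := E0 `\` K.
have [oA [c c0 isoA]] := isoperimetry_domain_expr (hypH_isoperimetry_in hH).
have [M1 M10 DM] : exists2 M1 : R, 0 < M1 & forall x, D x -> `|x| <= M1.
  have [M [_ DM]] := hypH_D_bounded hH; exists (`|M| + 1); first by rewrite ltr_wpDl.
  by move=> x Dx; apply: DM => //; rewrite ltr_pwDr// ler_norm.
have CD := hypH_C_sub hH.
have KM x : K x -> `|x| <= M1 + 1.
  by apply: closure_norm_le => z /CD /DM.
have AM x : A x -> `|x| <= M1 by move=> [/(hypH_E0_sub hH)/DM].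
(* Omega is bounded: outside [closure C] it agrees with E0, which lies in D. *)
have OM x : Omega x -> `|x| <= M1 + 1.
  move=> Ox; have [/KM//|Kx] := pselect (K x).
  have /AM/le_trans -> // : A x by rewrite /A -Obc.
  by rewrite lerDl.
have [z Cz] := hypH_C_nonempty hH.
have /nbhs_ballP[rho /= rho0 rhoC] := open_nbhs_nbhs (conj (hypH_C_open hH) Cz).
(* It bounds |x - z| + rho for all x in Omega, so the cone constant [theta] is the same at all
   points. *)
pose L := 2 * (M1 + 1) + rho.
have L0 : 0 < L by rewrite addr_gt0// mulr_gt0// addr_gt0.
pose theta := rho / L.
have theta0 : 0 < theta by rewrite divr_gt0.
have cone (x : 'rV[R]_N) (r : R) : closure A x -> ~ A x -> Omega x -> 0 < r ->
    (((theta * r) ^+ N)%:E <= leb (ball x r `\` K))%E.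
  move=> cAx _ Ox r0.
  have nCx : ~ C x.
    move=> Cx; have [q [[_ Kq] Cq]] := cAx _ (open_nbhs_nbhs (conj (hypH_C_open hH) Cx)).
    exact/Kq/subset_closure.
  have xz : `|x - z| + rho <= L.
    rewrite lerD2r; apply: le_trans (ler_normB _ _) _; rewrite mulr_natl mulr2n.
    by apply: lerD; [exact: OM|apply: KM; exact: subset_closure].
  have [p pr] := convex_exterior_ball (hypH_C_convex hH) rhoC rho0 nCx xz r0.
  apply: le_trans (leb_le pr); apply: leb_ball_ge.
  exact: mulr_gt0.
have [mA mA0 mAle] := open_leb_lower oA.
pose M : R := 1 + 4 * slice_const R n.
have M0 : 0 < M by rewrite addr_gt0// mulr_gt0// slice_const_gt0.
have cM0 : 0 < c * (2 * M) ^+ N by rewrite mulr_gt0// exprn_gt0// mulr_gt0.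
(* The bound 1 gives beta^(n+1) <= beta, the second term gives [beta_small], and the halved third
   one gives the strict inequality [beta_theta]. *)
pose beta := Num.min 1 (Num.min (c * (2 * M) ^+ N)^-1 (theta ^+ N / 2)).
have thN0 : 0 < theta ^+ N by rewrite exprn_gt0.
have beta0 : 0 < beta by rewrite !lt_min ltr01 invr_gt0 cM0 divr_gt0.
have beta1 : beta <= 1 by rewrite ge_min lexx.
have beta_small : c * (2 * M) ^+ N * beta <= 1.
  by rewrite mulrC -ler_pdivlMr// mul1r !ge_min lexx !orbT.
have beta_theta : beta ^+ n.+1 < theta ^+ N.
  apply: (@le_lt_trans _ _ beta).
    by rewrite exprS ler_piMr ?exprn_ile1// ltW.
  apply: (@le_lt_trans _ _ (theta ^+ N / 2)); first by rewrite !ge_min lexx !orbT.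
  by rewrite ltr_pdivrMr// ltr_pMr// ltr1n.
(* For y <= 1, y^N <= y, so the other two terms give the smallness conditions. *)
pose y0 := Num.min 1 (Num.min (beta ^+ n.+1 / c) (mA / (2 * c))).
have y00 : 0 < y0.
  by rewrite !lt_min ltr01 !divr_gt0// ?exprn_gt0// mulr_gt0.
have small y : 0 <= y -> y <= y0 ->
    c * y ^+ N <= beta ^+ n.+1 /\ 2 * (c * y ^+ N) <= mA.
  move=> yge0; rewrite !le_min => /andP[y1 /andP[yb ymA]].
  have yN : y ^+ N <= y by rewrite exprS ler_piMr ?exprn_ile1.
  split; first by rewrite mulrC -ler_pdivlMr// (le_trans yN).
  by rewrite mulrA mulrC -ler_pdivlMr ?mulr_gt0// (le_trans yN).
have isoO' (u : set 'rV[R]_N) (y : R) : open u -> u `<=` Omega ->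
    u `\` K = A -> 0 <= y -> (perimeter u Omega <= (y ^+ n.+1)%:E)%E ->
    (leb (Omega `\` u) <= (c2 * y ^+ N)%:E)%E.
  move=> ou uO uA yge0 Py; apply: le_trans (isoO u ou uO uA) _.
  rewrite EFinM lee_wpmul2l ?lee_fin ?(ltW c20)//.
  apply: poweR_expr_ratio_le => //.
  exact: perimeter_ge0.
have core (w : set 'rV[R]_N) (y : R) := leb_complement_le oO oA Obc isoA isoO' cone
  beta0 beta_small beta_theta mAle (w := w) (y := y).
pose F := filling_const n c c2 beta.
have F0 : 0 < F.
  rewrite /F /filling_const ltr_wpDl ?exprn_gt0 ?divr_gt0// addr_ge0 ?(ltW c0)//.
  rewrite mulr_ge0 ?(ltW c20)// exprn_ge0// addr_ge0// mulr_ge0 ?(ltW (perimeter_const_gt0 _ _))//.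
  rewrite addr_ge0// divr_ge0 ?exprn_ge0 ?(ltW beta0)// /sphere_const.
  by rewrite divr_ge0// mulr_ge0 ?(ltW (slice_const_gt0 _ _))// mulr_ge0// exprn_ge0.
pose G := (2 * (M1 + 2)) ^+ N.
have OG : (leb Omega <= G%:E)%E.
  have M20 : 0 <= M1 + 2 by rewrite addr_ge0// ltW.
  apply: le_trans (leb_ball_le (0 : 'rV[R]_N) M20); apply: leb_le => x /OM xM.
  by rewrite ball_rowE /= sub0r normrN; apply: le_lt_trans xM _; rewrite ltrD2l ltr1n.
have G0 : 0 <= G by rewrite exprn_ge0// mulr_ge0// addr_ge0// ltW.
(* [F] serves for y <= y0; for larger y the total volume [G] is at most (G / y0^N) y^N. *)
split => //; exists (F + G / y0 ^+ N) => [|w ow wO].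
  by rewrite ltr_wpDr// divr_ge0// exprn_ge0// ltW.
set H := hausdorff _ _.
have cst0 : 0 < F + G / y0 ^+ N by rewrite ltr_wpDr// divr_ge0// exprn_ge0// ltW.
have [Hoo|/eqP Hoo] := eqVneq H +oo%E.
  rewrite Hoo poweRyr; last by rewrite mulf_neq0 ?invr_eq0 ?pnatr_eq0.
  by rewrite gt0_muley ?leey// lte_fin.
have H0 : (0 <= H)%E by exact: hausdorff_ge0.
have Hlt : (H < +oo)%E by rewrite ltey; exact/eqP.
have Hfin : H \is a fin_num by rewrite ge0_fin_numE.
pose y := fine H `^ n.+1%:R^-1.
have yge0 : 0 <= y by exact: powR_ge0.
have yH : y ^+ n.+1 = fine H.
  by rewrite -powR_mulrn// -powRrM mulVf ?pnatr_eq0// powRr1// fine_ge0.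
have HyE : H = (y ^+ n.+1)%:E by rewrite yH fineK.
have -> : (H `^ (N%:R / N.-1%:R) = (y ^+ N)%:E)%E.
  by rewrite HyE poweR_EFin powR_expr_ratio.
have Hy : (H <= (y ^+ n.+1)%:E)%E by rewrite -HyE.
rewrite -EFinM mulrDl.
have [yy0|y0y] := leP y y0; last first.
  apply: (@le_trans _ _ (leb w)); first by rewrite ge_min lexx.
  apply: le_trans (leb_le wO) (le_trans OG _); rewrite lee_fin.
  apply: (@le_trans _ _ (G / y0 ^+ N * y ^+ N)).
    rewrite -mulrA ler_peMr// mulrC ler_pdivlMr ?exprn_gt0// mul1r.
    by rewrite lerXn2r ?nnegrE ?(ltW y00)// ltW.
  by rewrite lerDr mulr_ge0 ?exprn_ge0// ltW.
have [small1 small2] := small y yge0 yy0.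
suff : (mine (leb w) (leb (Omega `\` w)) <= (F * y ^+ N)%:E)%E.
  move=> /le_trans; apply; rewrite lee_fin lerDl mulr_ge0 ?exprn_ge0// divr_ge0//.
  by rewrite exprn_ge0// ltW.
have AO : A `<=` Omega by rewrite /A -Obc => x [].
pose u := w `&` A.
have ou : open u by exact: openI.
have uA : u `<=` A by move=> x [].
have Hu : (hausdorff n.+1 (tboundary u `&` A) <= (y ^+ n.+1)%:E)%E.
  apply: le_trans Hy; apply: le_hausdorff => x [[cx nx] Ax].
  split; last exact: AO.
  split; first by have [] := closureI cx.
  move=> /interior_subset wx; apply: nx; exact: open_nbhs_nbhs.
have := isoA u y ou uA yge0 Hu; rewrite ge_min => /orP[uc|Auc].
  (* Here w has small volume in A, so the roles are exchanged: the complement of [w2] in Omega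
     contains w. *)
  pose w2 := Omega `\` closure w.
  have ow2 : open w2 by apply: openI => //; apply: closed_openC; exact: closed_closure.
  have w2O : w2 `<=` Omega by move=> x [].
  have bd2 : tboundary w2 `&` Omega `<=` tboundary w `&` Omega.
    move=> x [[cx nx] Ox].
    have cwx : closure w x.
      apply: contrapT => cwx; apply: nx; exact: open_nbhs_nbhs.
    split => //; split => // /interior_subset wx.
    have [q [[_ cwq] wq]] := cx _ (open_nbhs_nbhs (conj ow wx)).
    exact/cwq/subset_closure.
  have Hw2 : (hausdorff n.+1 (tboundary w2 `&` Omega) <= (y ^+ n.+1)%:E)%E.
    by apply: le_trans (le_hausdorff _ bd2) Hy.
  have Aw2 : (leb (A `\` w2) <= (c * y ^+ N)%:E)%E.
    (* A \ w2 consists of the points of A in [closure w]: those of u, and boundary points of w,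
       which form a null set. *)
    apply: (@le_trans _ _ (leb (u `|` (tboundary w `&` Omega)))).
      apply: leb_le => x [Ax w2x]; have Ox := AO x Ax.
      have [wx|wx] := pselect (w x); [by left|right].
      split => //; split; last by move=> /interior_subset.
      by apply: contrapT => cwx; apply: w2x.
    apply: le_trans (outer_measureU2 _ _ _) _.
    by rewrite [X in (_ + X)%E](leb_null_of_hausdorff Hlt) adde0.
  rewrite ge_min; apply/orP; left.
  apply: le_trans (core w2 y ow2 w2O yge0 Hw2 Aw2 small1 small2).
  by apply: leb_le => x wx; split; [exact: wO|move=> [_]; apply; exact: subset_closure].
rewrite ge_min; apply/orP; right.
apply: (core w y ow wO yge0 Hy _ small1 small2).
by apply: le_trans Auc; apply: leb_le => x [Ax wx]; split => // -[].
Qed.
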